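(* Let $Y=(Y_n)_{n\in\mathbb{N}_0}$, $Y_n=\sum_{k=0}^n\sum_{i=1}^{J_k}X_{i,k}(n-k)$, be the Galton–Watson process with immigration described in the context. Suppose that $$\mathbb{P}\{\log J>x\}\sim x^{-\alpha}\ell(x),\qquad x\to\infty,$$ for some $\alpha\in(0,1]$ and some function $\ell$ slowly varying at $\infty$, and if $\alpha=1$ suppose additionally that $\lim_{x\to\infty}\ell(x)=\infty$. Let $(b_n)_{n\in\mathbb{N}}$ be positive numbers with $\lim_{n\to\infty}n\,\mathbb{P}\{\log J>b_n\}=1$. Then, as $n\to\infty$, $$\frac{\log^+\big(Y_{[n\cdot]}\big)}{b_n}\ \Rightarrow\ \sup_{t_k^{(1,\alpha)}\le\cdot} j_k^{(1,\alpha)},$$ weakly on the Skorokhod space $D[0,\infty)$ with the $J_1$-topology.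
   Context: $\mathbb{N}_0=\mathbb{N}\cup\{0\}$. The families $(X_{i,k})_{i\in\mathbb{N},k\in\mathbb{N}_0}$ and $(J_k)_{k\in\mathbb{N}_0}$ are mutually independent, each consisting of i.i.d. random objects; each $X_{i,k}=(X_{i,k}(n))_{n\in\mathbb{N}_0}$ is a Galton–Watson process with $X_{i,k}(0)=1$ and offspring mean $\mathbb{E}X_{i,k}(1)=\mu\in(0,\infty)$; each $J_k$ is a nonnegative integer-valued random variable with $\mathbb{P}\{J_k=0\}<1$, and $J$ denotes a random variable with the law of $J_k$. $\log^+x=\max(\log x,0)$, $[\cdot]$ is the integer part. For $a,b>0$, $N^{(a,b)}=\sum_{k}\varepsilon_{(t_k^{(a,b)},\,j_k^{(a,b)})}$ is a Poisson random measure on $[0,\infty)\times(0,\infty]$ with mean measure $\mathrm{Leb}\times\mu_{a,b}$, where $\mu_{a,b}((x,\infty])=ax^{-b}$ for $x>0$. The supremum over the empty set is $0$. *)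

(* Defs.v *)
From HB Require Import structures.
From mathcomp Require Import all_boot all_order all_algebra.
From mathcomp Require Import all_classical all_reals all_analysis.
From mathcomp Require Import measurable_realfun.
Set Implicit Arguments. Unset Strict Implicit. Unset Printing Implicit Defensive.
Import Order.TTheory GRing.Theory Num.Theory.
Import numFieldNormedType.Exports.
Local Open Scope classical_set_scope.
Local Open Scope ring_scope.

Section Defs.
Variable R : realType.

(** log^+ x = max(log x, 0), with log^+ 0 = 0. *)
Definition logp (x : R) : R := Num.max (ln x) 0.

Definition slowly_varying (l : R -> R) : Prop :=
  (exists a : R, (forall x, a < x -> 0 < l x) /\
                 measurable_fun [set x | a < x] l) /\
  forall lam : R, 0 < lam -> (l (lam * x) / l x) @[x --> +oo] --> (1 : R).

(** Skorokhod space D[0,oo): functions on [0,oo) (values at t<0 are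
    irrelevant) which are right-continuous with left limits. *)
Definition cadlag (x : R -> R) : Prop :=
  (forall t, 0 <= t -> x @ t^'+ --> x t) /\
  (forall t, 0 < t -> cvg (x @ t^'-)).

Definition time_change (lam : R -> R) : Prop :=
  lam 0 = 0 /\
  {within [set t | 0 <= t], continuous lam} /\
  (forall s t, 0 <= s -> s < t -> lam s < lam t) /\
  (forall y, 0 <= y -> exists2 t, 0 <= t & lam t = y).

(** J1 convergence in D[0,oo) (Billingsley 1999, Thm 16.2): there are time
    changes lam_n with sup_{t>=0} |lam_n t - t| -> 0 and, for every T > 0,
    sup_{0<=t<=T} |x_n (lam_n t) - x t| -> 0. *)
Definition J1_cvg (xs : nat -> R -> R) (x : R -> R) : Prop :=
  exists lams : nat -> R -> R,
    (forall n, time_change (lams n)) /\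
    (forall e : R, 0 < e ->
       \forall n \near \oo, forall t, 0 <= t -> `|lams n t - t| <= e) /\
    (forall T e : R, 0 < T -> 0 < e ->
       \forall n \near \oo, forall t, 0 <= t <= T ->
          `|xs n (lams n t) - x t| <= e).

(** (sequential, equivalently -- J1 being metrizable -- topological)
    continuity of a functional on (D[0,oo), J1). *)
Definition J1_continuous (f : (R -> R) -> R) : Prop :=
  forall (xs : nat -> R -> R) (x : R -> R),
    cadlag x -> (forall n, cadlag (xs n)) -> J1_cvg xs x ->
    f (xs n) @[n --> \oo] --> f x.

Definition bounded_functional (f : (R -> R) -> R) : Prop :=
  exists M : R, forall x, `|f x| <= M.

Definition D_weak_cvg {d} {Omega : measurableType d} (P : probability Omega R)
  (Z : nat -> Omega -> R -> R)
  {d'} {Omega' : measurableType d'} (Q : probability Omega' R)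
  (Zl : Omega' -> R -> R) : Prop :=
  forall f : (R -> R) -> R, bounded_functional f -> J1_continuous f ->
    (\int[P]_w (f (Z n w))%:E)%E @[n --> \oo] --> (\int[Q]_w (f (Zl w))%:E)%E.

Definition nat_rv {d} {Omega : measurableType d} (X : Omega -> nat) : Prop :=
  forall A : set nat, measurable (X @^-1` A).

Definition mutually_independent {d} {Omega : measurableType d}
  (P : probability Omega R) {I : eqType} (F : I -> Omega -> nat) : Prop :=
  forall (s : seq I) (A : I -> set nat), uniq s ->
    (P [set w | forall i, i \in s -> A i (F i w)] =
    \big[*%E/1%E]_(i <- s) P (F i @^-1` A i))%E.

(** X i k is built from offspring numbers xi i k m l (number of children of
    the l-th individual of generation m of the process X_{i,k}):
    X_{i,k}(0) = 1, X_{i,k}(m+1) = sum_{l < X_{i,k}(m)} xi_{i,k,m,l}. *)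
Fixpoint GW (xi : nat -> nat -> nat) (m : nat) : nat :=
  match m with
  | 0 => 1%N
  | m'.+1 => (\sum_(l < GW xi m') xi m' l)%N
  end.

Definition GWI {Omega : Type} (xi : nat -> nat -> nat -> nat -> Omega -> nat)
  (J : nat -> Omega -> nat) (n : nat) (w : Omega) : nat :=
  (\sum_(0 <= k < n.+1) \sum_(1 <= i < (J k w).+1)
      GW (fun m l => xi i k m l w) (n - k))%N.

Definition GWI_family {Omega : Type}
  (xi : nat -> nat -> nat -> nat -> Omega -> nat) (J : nat -> Omega -> nat)
  (ix : (nat * nat * nat * nat) + nat) : Omega -> nat :=
  match ix with
  | inl (i, k, m, l) => xi i k m l
  | inr k => J k
  end.

Definition poisson_pmf (lam : R) (k : nat) : R :=
  expR (- lam) * lam ^+ k / (k `!)%:R.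

(** mean measure Leb x mu on [0,oo) x (0,oo], computed as in the
    definition of the product measure: B |-> int_{[0,oo)} mu(B_t) dt. *)
Definition mean_measure (mu : set (\bar R) -> \bar R)
  (B : set (R * \bar R)) : \bar R :=
  (\int[lebesgue_measure]_(t in [set t : R | (0 <= t)%R]) mu (xsection B t))%E.

Definition is_mu_ab (a b : R) (mu : measure (\bar R) R) : Prop :=
  mu [set y : \bar R | (y <= 0)%E] = 0%E /\
  forall x : R, 0 < x -> mu [set y : \bar R | (x%:E < y)%E] = (a * x `^ (- b))%:E.

Definition count_pts {Omega : Type} (t : nat -> Omega -> R)
  (j : nat -> Omega -> \bar R) (w : Omega) (B : set (R * \bar R)) : \bar R :=
  (\sum_(0 <= k <oo) (if `[< B (t k w, j k w) >] then 1 else 0)%:E)%E.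

Definition is_PRM {d} {Omega : measurableType d} (Q : probability Omega R)
  (t : nat -> Omega -> R) (j : nat -> Omega -> \bar R)
  (m : set (R * \bar R) -> \bar R) : Prop :=
  (forall k, measurable_fun setT (t k)) /\ (forall k, measurable_fun setT (j k)) /\
  forall (n : nat) (B : 'I_n -> set (R * \bar R)) (c : 'I_n -> nat),
    (forall i, measurable (B i)) ->
    (forall i, (m (B i) < +oo)%E) ->
    (forall i i', i != i' -> B i `&` B i' = set0) ->
    (Q [set w | forall i, count_pts t j w (B i) = (c i)%:R%:E] =
    (\prod_(i < n) poisson_pmf (fine (m (B i))) (c i))%:E)%E.

Definition sup0 (A : set (\bar R)) : \bar R :=
  if `[< A = set0 >] then 0%E else ereal_sup A.

Definition sup_process {Omega : Type} (t : nat -> Omega -> R)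
  (j : nat -> Omega -> \bar R) (w : Omega) (s : R) : R :=
  fine (sup0 [set j k w | k in [set k | t k w <= s]]).

End Defs.

(* Main.v *)
Require Import Defs.
From HB Require Import structures.
From mathcomp Require Import all_boot all_order all_algebra.
From mathcomp Require Import all_classical all_reals all_analysis.
From mathcomp Require Import measurable_realfun.
From mathcomp Require Import ring lra.
Import Order.TTheory GRing.Theory Num.Theory.
Import numFieldNormedType.Exports.
Local Open Scope classical_set_scope.
Local Open Scope ring_scope.
Set Implicit Arguments. Unset Strict Implicit. Unset Printing Implicit Defensive.

(** Write G x = P(log J > x). Since the tail G is monotone and G(2x)/G(x) tends to
    2^-alpha, x G(x) tends to infinity (for alpha = 1 because l does), so n = o(b_n).
    Offspring numbers have finite mean and are positive with positive probability, so
    over a horizon of order n the progeny of J immigrants is J up to factors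
    exp(o(b_n)): log^+ Y_m / b_n is uniformly close to max_(k <= m) log J_k / b_n,
    the running maximum of the points (k / n, log J_k / b_n).

    J1-continuous functionals are only sequentially continuous, so convergence is
    proved by a discretization. Cut time into small columns and label a configuration
    by the rounded height of its highest point in each column. Outside an event of
    small probability no point above the level e sits at time 0 and no column carries
    two of them, and then any two running maxima with the same label are J1-close: a
    piecewise linear time change matches their jumps. The label laws converge because
    they are determined by the probabilities that boxes are free of points, and these
    are products of powers of 1 - G(y b_n) on one side and exponentials on the other.
    Bounding f on each cell by its supremum and infimum squeezes the integrals; the
    gap vanishes by Borel-Cantelli and dominated convergence. *)

(** * Time changes *)

Section time_changes.
Variable R : realType.
Implicit Types (p q slope y C T : R) (s : nat -> R).

Definition ramp p q slope y : R := y + (slope - 1) * Num.max 0 (Num.min y q - p).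

Lemma ramp_id p q slope y : y <= p -> ramp p q slope y = y.
Proof.
move=> yp; rewrite /ramp (_ : Num.max _ _ = 0) ?mulr0 ?addr0//.
by apply: max_l; rewrite subr_le0 ge_min yp.
Qed.

Lemma ramp_ge p q slope y : p <= q -> q <= y ->
  ramp p q slope y = y - q + (p + slope * (q - p)).
Proof.
by move=> pq qy; rewrite /ramp min_r// max_r ?subr_ge0//; ring.
Qed.

Lemma ramp_lt p q slope : 0 < slope -> {homo ramp p q slope : y y' / y < y'}.
Proof.
move=> slope0 y y' yy'; rewrite /ramp.
set g := Num.max 0 (Num.min y q - p); set g' := Num.max 0 (Num.min y' q - p).
have [gg' g'g] : g <= g' /\ g' - g <= y' - y.
  rewrite /g /g'; case: (leP 0 (Num.min y q - p)); case: (leP 0 (Num.min y' q - p));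
  by case: (leP y q); case: (leP y' q); split; lra.
by have [g'0|] := eqVneq g' g; [rewrite g'0; lra | rewrite neq_lt; nra].
Qed.

Lemma continuous_ramp p q slope : continuous (ramp p q slope).
Proof.
move=> y; apply: cvgD; first exact: cvg_id.
apply: cvgM; first exact: cvg_cst.
apply: (@continuous_max _ _ (cst 0) (fun y => Num.min y q - p)).
  exact: cvg_cst.
apply: cvgB; last exact: cvg_cst.
by apply: (@continuous_min _ _ id (cst q)); [exact: cvg_id|exact: cvg_cst].
Qed.

Lemma increasing_interpolation s s' A : increasing_seq s -> increasing_seq s' ->
  s 0%N = s' 0%N ->
  exists lam : R -> R, [/\ continuous lam, {homo lam : t u / t < u},
    forall a, (a <= A)%N -> lam (s a) = s' a &
    forall t, s A <= t -> lam t = t - s A + s' A].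
Proof.
move=> s_incr s'_incr s0; elim: A => [|A [lam [lamC lam_lt lams lam_tail]]].
  exists id; split => //; first by move=> t; exact: cvg_id.
    by move=> a; rewrite leqn0 => /eqP ->.
  by move=> t _; rewrite s0 subrK.
have sA : s A < s A.+1 by exact/(increasing_seqP s).2.
have s'A : s' A < s' A.+1 by exact/(increasing_seqP s').2.
pose q := s A.+1 - s A + s' A.
pose slope := (s' A.+1 - s' A) / (s A.+1 - s A).
have s'q : s' A < q by rewrite ltrDr subr_gt0.
have slopeE : s' A + slope * (q - s' A) = s' A.+1.
  by rewrite /slope /q; field; rewrite subr_eq0 gt_eqF.
have tail t : s A.+1 <= t -> ramp (s' A) q slope (lam t) = t - s A.+1 + s' A.+1.
  move=> At; rewrite lam_tail ?(le_trans (ltW sA))//.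
  rewrite ramp_ge ?(ltW s'q) ?slopeE /q; lra.
exists (ramp (s' A) q slope \o lam); split.
- by move=> t; apply: continuous_comp; [exact: lamC|exact: continuous_ramp].
- move=> t u tu; apply: ramp_lt; last exact: lam_lt.
  by rewrite divr_gt0// subr_gt0.
- move=> a; rewrite leq_eqVlt => /predU1P[->|aA] /=.
    by rewrite tail// subrr add0r.
  by rewrite lams// ramp_id// s'_incr.
- exact: tail.
Qed.

Lemma time_change_eventually_shift (g : R -> R) C T : g 0 = 0 -> continuous g ->
  {homo g : t u / t < u} -> (forall t, T <= t -> g t = t + C) -> time_change g.
Proof.
move=> g0 gC g_lt gT; split=> //.
split; first by apply: continuous_subspaceT => ?; exact: gC.
split=> [t u _|y y0]; first exact: g_lt.
pose M := Num.max 0 (Num.max T (y - C)).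
have [M0 MT MyC] : [/\ 0 <= M, T <= M & y - C <= M] by rewrite !le_max !lexx ?orbT.
have yM : y <= g M by rewrite gT// -lerBlDr.
have [|||t] := @IVT R g 0 M y => //.
- by apply: continuous_subspaceT => ?; exact: gC.
- by rewrite g0 min_l ?max_r ?y0 ?(le_trans y0).
- by rewrite in_itv /= => /andP[t0 _] gt; exists t.
Qed.

Lemma time_change_interpolation s s' A : increasing_seq s -> increasing_seq s' ->
  s 0%N = 0 -> s' 0%N = 0 ->
  exists lam : R -> R, [/\ time_change lam, {homo lam : t u / t < u},
    forall a, (a <= A)%N -> lam (s a) = s' a &
    forall t, s A <= t -> lam t = t - s A + s' A].
Proof.
move=> s_incr s'_incr s0 s'0.
have [|lam [lamC lam_lt lams lam_tail]] := increasing_interpolation A s_incr s'_incr.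
  by rewrite s0 s'0.
exists lam; split=> //.
apply: (@time_change_eventually_shift _ (s' A - s A) (s A)) => //.
  by rewrite -[X in lam X]s0 lams.
by move=> t /lam_tail ->; ring.
Qed.

Lemma time_change_id : time_change (id : R -> R).
Proof.
by apply: (@time_change_eventually_shift _ 0 0) => // t;
  [exact: cvg_id|rewrite addr0].
Qed.

End time_changes.

Section pieces.
Context disp (T : orderType disp).
Implicit Types (s : nat -> T) (t : T).
Local Open Scope order_scope.

Lemma piece_right s A t : s 0%N <= t < s A ->
  exists2 a, (a < A)%N & s a <= t < s a.+1.
Proof.
elim: A => [/andP[/le_lt_trans/[apply]]|A IH /andP[t0 tA]]; first by rewrite ltxx.
have [tA'|At] := ltP t (s A); last by exists A; rewrite ?At.
by have [|a aA at'] := IH; [rewrite t0|exists a => //; exact: ltnW].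
Qed.

Lemma piece_left s A t : s 0%N < t <= s A ->
  exists2 a, (a < A)%N & s a < t <= s a.+1.
Proof.
elim: A => [/andP[/lt_le_trans/[apply]]|A IH /andP[t0 tA]]; first by rewrite ltxx.
have [tA'|At] := leP t (s A); last by exists A; rewrite ?At.
by have [|a aA at'] := IH; [rewrite t0|exists a => //; exact: ltnW].
Qed.

End pieces.

Section columns.
Variable R : realType.
Implicit Types (h u : R).

Definition in_column h (a : nat) u := a%:R * h <= u < a.+1%:R * h.

Lemma ex_in_column h A u : 0 < h -> 0 <= u < A%:R * h ->
  exists2 a, (a < A)%N & in_column h a u.
Proof.
by move=> h0 uA; apply: (@piece_right _ _ (fun a => a%:R * h)); rewrite mul0r.
Qed.

Lemma in_column_inj h a a' u : 0 < h -> in_column h a u -> in_column h a' u -> a = a'.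
Proof.
move=> h0 /andP[au ua] /andP[a'u ua']; apply/eqP; rewrite eqn_leq.
have := le_lt_trans au ua'; have := le_lt_trans a'u ua.
by rewrite !ltr_pM2r// !ltr_nat !ltnS => -> ->.
Qed.

End columns.

(** * The Skorokhod topology *)

Section Skorokhod.
Variable R : realType.
Implicit Types (e h T : R) (s : nat -> R) (x y z : R -> R).

Definition J1_close e x y := exists lam : R -> R, [/\ time_change lam,
  forall t, 0 <= t -> `|lam t - t| <= e &
  forall t, 0 <= t <= e^-1 -> `|y (lam t) - x t| <= e].

Lemma J1_cvg_of_close x (ys : nat -> R -> R) (del : nat -> R) :
  (forall k, 0 < del k) -> del k @[k --> \oo] --> 0 ->
  (\forall k \near \oo, J1_close (del k) x (ys k)) -> J1_cvg ys x.
Proof.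
move=> del_gt0 del_cvg0 x_ys.
have /choice[lam lamP] k : exists lam : R -> R, [/\ time_change lam,
    forall t, 0 <= t -> `|lam t - t| <= del k & J1_close (del k) x (ys k) ->
      forall t, 0 <= t <= (del k)^-1 -> `|ys k (lam t) - x t| <= del k].
  have [[lam [lamT lam_id lam_xy]]|far] := pselect (J1_close (del k) x (ys k)).
    by exists lam.
  by exists id; split=> // [|t _]; [exact: time_change_id|rewrite subrr normr0 ltW].
have del_le e : 0 < e -> \forall k \near \oo, del k <= e.
  exact: cvgr_le del_cvg0 _.
exists lam; split; first by move=> k; case: (lamP k).
split=> [e e0|T e T0 e0].
  apply: filterS (del_le _ e0) => k ke t t0.
  by have [_ /(_ _ t0)/le_trans-> ] := lamP k.
have T'0 : 0 < T^-1 by rewrite invr_gt0.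
apply: filterS3 x_ys (del_le _ e0) (del_le _ T'0) => k close ke kT t /andP[t0 tT].
have [_ _ /(_ close) lam_close] := lamP k; apply: le_trans (lam_close _ _) ke.
by rewrite t0 (le_trans tT)// -[leLHS]invrK lef_pV2 ?posrE.
Qed.

Lemma cadlag_of_partitions z :
  (forall e T, 0 < e -> exists A s, [/\ s 0%N = 0, T < s A &
    forall a u v, (a < A)%N -> s a <= u < s a.+1 -> s a <= v < s a.+1 ->
      `|z u - z v| <= e]) ->
  cadlag z.
Proof.
move=> partition; split => t t0.
  apply/cvgrPdist_le => e e0; have [A [s [s0 tA osc]]] := partition e t e0.
  have [|a aA /andP[at' ta]] := @piece_right _ R s A t; first by rewrite s0 t0.
  have near_piece : \forall u \near t^'+, s a <= u < s a.+1.
    near=> u; apply/andP; split; last by near: u; exact: nbhs_right_lt.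
    by apply: le_trans at' _; near: u; exact: nbhs_right_ge.
  by apply: filterS near_piece => u; apply: osc; rewrite ?at'.
apply: cauchy_cvg; apply/cauchy_ballP => e e0; rewrite near_simpl.
have e20 : 0 < e / 2 by rewrite divr_gt0.
have [A [s [s0 tA osc]]] := partition _ t e20.
have [|a aA /andP[at' ta]] := @piece_left _ R s A t; first by rewrite s0 t0 ltW.
have near_piece : \forall u \near t^'-, s a <= u < s a.+1.
  near=> u; apply/andP; split; first by near: u; exact: nbhs_left_ge.
  by apply: lt_le_trans ta; near: u; exact: nbhs_left_lt.
near=> uv => /=; rewrite -ball_normE /ball_ /=.
apply: (@le_lt_trans _ _ (e / 2)); last by lra.
apply: (osc a) => //; near: uv.
  exists ([set u | s a <= u < s a.+1], setT); last by case=> ? ? [].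
  by split=> //=; exact: filterT.
exists (setT, [set u | s a <= u < s a.+1]); last by case=> ? ? [].
by split=> //=; exact: filterT.
Unshelve. all: by end_near. Qed.

Lemma cadlag_scaled_sequence (g : nat -> R) (n : nat) : (0 < n)%N ->
  cadlag (fun t => g (Num.truncn (n%:R * t))).
Proof.
move=> n0; have n0R : (0 : R) < n%:R by rewrite ltr0n.
apply: cadlag_of_partitions => e T e0.
exists (Num.truncn (n%:R * T)).+1, (fun a => a%:R / n%:R).
split=> [||a u v _ ua va]; first by rewrite mul0r.
  by rewrite ltr_pdivlMr// mulrC truncnS_gt.
have truncE (w : R) : a%:R / n%:R <= w < a.+1%:R / n%:R -> Num.truncn (n%:R * w) = a.
  by rewrite ler_pdivrMr// ltr_pdivlMr// mulrC; exact: truncn_def.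
by rewrite !truncE// subrr normr0 ltW.
Qed.

Definition running_height e (c : nat -> nat) (a : nat) : R := (\max_(i < a) c i)%:R * e.

(* Paths within 2 e of a step function whose a-th jump, leading to the highest of
   the first a labels, occurs at an unspecified time of the a-th column
   [(a - 1) h, a h[. *)
Definition step_cell h (A : nat) e (c : nat -> nat) : set (R -> R) :=
  [set z | exists s, [/\ s 0%N = 0, increasing_seq s,
    forall a, in_column h a (s a.+1) &
    forall a u, (a < A)%N -> s a <= u < s a.+1 ->
      `|z u - running_height e c a| <= 2 * e]].

Lemma eq_step_cell h A e (c c' : nat -> nat) z : (forall a, (a < A)%N -> c a = c' a) ->
  step_cell h A e c z -> step_cell h A e c' z.
Proof.
move=> cc' [s [s0 s_incr s_col zs]]; exists s; split=> // a u aA ua.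
suff <- : running_height e c a = running_height e c' a by exact: zs.
congr (_%:R * _); apply: eq_bigr => i _.
by rewrite cc'// (ltn_trans (ltn_ord i)).
Qed.

Lemma step_cell_partition h A e c z : step_cell h A.+1 e c z ->
  exists s, [/\ s 0%N = 0, A%:R * h <= s A.+1 &
    forall a u v, (a < A.+1)%N -> s a <= u < s a.+1 -> s a <= v < s a.+1 ->
      `|z u - z v| <= 4 * e].
Proof.
move=> [s [s0 _ s_col zs]]; exists s; split=> //; first by have /andP[] := s_col A.
move=> a u v aA /(zs _ _ aA) + /(zs _ _ aA).
by rewrite !ler_norml; lra.
Qed.

(* The time change matching the jumps of x with those of y moves every time by at
   most two columns. *)
Lemma step_cell_close h A e c d x y : 0 < h -> 2 * h <= d -> 4 * e <= d ->
  d^-1 < A%:R * h -> step_cell h A.+1 e c x -> step_cell h A.+1 e c y ->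
  J1_close d x y.
Proof.
move=> h0 hd ed dA [s [s0 s_incr s_col xs]] [s' [s'0 s'_incr s'_col ys']].
have [lam [lamT lam_lt lams lam_tail]] :=
  time_change_interpolation A.+1 s_incr s'_incr s0 s'0.
have lam_piece a t : (a < A.+1)%N -> s a <= t < s a.+1 -> s' a <= lam t < s' a.+1.
  move=> aA /andP[at' ta]; rewrite -!lams ?(ltnW aA)// lam_lt// andbT.
  by move: at'; rewrite le_eqVlt => /predU1P[->|/lam_lt/ltW].
have piece_width a (p : nat -> R) : p 0%N = 0 ->
    (forall b, in_column h b (p b.+1)) ->
    a.-1%:R * h <= p a /\ p a.+1 < a.+1%:R * h.
  move=> p0 p_col; have /andP[_ ->] := p_col a.
  by case: a => [|a]; [rewrite p0 mul0r|have /andP[] := p_col a].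
have widthE a : a.+1%:R * h <= a.-1%:R * h + 2 * h.
  by rewrite -mulrDl -natrD ler_pM2r// ler_nat; case: a => // a; rewrite addn2.
exists lam; split=> // [t t0|t /andP[t0 td]].
  apply: le_trans hd; have [tA|At] := ltP t (s A.+1); last first.
    have := s_col A; have := s'_col A; rewrite /in_column.
    by rewrite lam_tail// -natr1 mulrDl mul1r ler_norml; lra.
  have [|a aA ta] := @piece_right _ R s A.+1 t; first by rewrite s0 t0.
  have := lam_piece _ _ aA ta; have := piece_width a s s0 s_col.
  have := piece_width a s' s'0 s'_col; have := widthE a.
  by rewrite ler_norml; lra.
have [|a aA ta] := @piece_right _ R s A.+1 t.
  by rewrite s0 t0 (le_lt_trans td)// (lt_le_trans dA)//; have /andP[] := s_col A.
have := xs _ _ aA ta; have := ys' _ _ aA (lam_piece _ _ aA ta).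
by rewrite !ler_norml; lra.
Qed.

End Skorokhod.

(** * Weak convergence by discretization *)

Section half_powers.
Variable R : realType.

Definition half_pow (k : nat) : R := 1 / (2 ^ k.+1)%:R.

Lemma half_pow_gt0 k : 0 < half_pow k.
Proof. by rewrite divr_gt0// ltr0n expn_gt0. Qed.

Lemma half_pow_cvg0 : half_pow k @[k --> \oo] --> 0.
Proof.
have -> : half_pow = geometric (1 / 2) (1 / 2).
  apply/funext => k; rewrite /half_pow /geometric /= -exprS natrX expr_div_n.
  by rewrite expr1n.
by apply: cvg_geometric; rewrite ger0_norm//; lra.
Qed.

End half_powers.

Section finite_labels.
Local Open Scope ereal_scope.
Context d (T : measurableType d) (R : realType).

(* The integral is defined for every function and is monotone, measurable or not. *)
Lemma le_integral_pointwise (mu : {measure set T -> \bar R}) (f g : T -> \bar R) :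
  (forall x, f x <= g x) -> \int[mu]_x f x <= \int[mu]_x g x.
Proof.
move=> fg; rewrite /integral !patch_setT; apply: leeB; apply: ereal_sup_le;
  move=> _ [k kP <-]; exists k => //= x; apply: (le_trans (kP x)).
- by rewrite !funeposE ge_max le_max le_max fg lexx orbT.
- by rewrite !funenegE ge_max le_max le_max leeN2 fg lexx orbT.
Qed.

Lemma ae_near_notin (mu : {measure set T -> \bar R}) (F : nat -> set T) :
  (forall k, measurable (F k)) -> \sum_(0 <= k <oo) mu (F k) < +oo ->
  {ae mu, forall w, \forall k \near \oo, ~ F k w}.
Proof.
move=> mF sumF; exists (lim_sup_set F); split.
- by apply: bigcap_measurable => // k _; exact: bigcup_measurable.
- exact: lim_sup_set_cvg0.
- move=> w /= often k _; apply: contrapT => kF; apply: often; exists k => // j kj Fj.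
  by apply: kF; exists j.
Qed.

Lemma ae_near_notin_half_pow (mu : {measure set T -> \bar R}) (F : nat -> set T) :
  (forall k, measurable (F k)) -> (forall k, mu (F k) <= (half_pow R k)%:E) ->
  {ae mu, forall w, \forall k \near \oo, ~ F k w}.
Proof.
move=> mF F_le; apply: ae_near_notin => //.
apply: (@le_lt_trans _ _ 1); last by rewrite ltry.
apply: le_trans (epsilon_trick0 xpredT (@ler01 R)).
by apply: lee_nneseries => // k _; exact: F_le.
Qed.

Context (P : probability T R) (L : finType) (lab : T -> L).
Hypothesis measurable_lab : forall c, measurable (lab @^-1` [set c]).

Lemma measurable_label_pred (p : pred L) : measurable [set w | p (lab w)].
Proof.
rewrite (_ : [set _ | _] = \bigcup_(c in [set c | p c]) lab @^-1` [set c]).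
  by apply: fin_bigcup_measurable => //; exact: finite_finset.
by apply/seteqP; split => w /= => [pw|[c pc ->]//]; exists (lab w).
Qed.

Lemma measurable_label_fun (u : L -> R) : measurable_fun setT (u \o lab).
Proof.
move=> _ B _; rewrite setTI (_ : _ @^-1` B = [set w | u (lab w) \in B]).
  exact: measurable_label_pred (fun c => u c \in B).
by apply/seteqP; split => w /=; rewrite inE.
Qed.

Lemma integrable_label (u : L -> R) : P.-integrable setT (EFin \o u \o lab).
Proof.
apply: (@le_integrable _ _ _ _ setT measurableT _ (cst (\sum_c `|u c|)%:E)).
- exact/measurable_EFinP/measurable_label_fun.
- move=> w _ /=; rewrite lee_fin [leRHS]ger0_norm ?sumr_ge0//.
  by rewrite (bigD1 (lab w))//= lerDl sumr_ge0.
- exact: finite_measure_integrable_cst.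
Qed.

Lemma integral_label (u : L -> R) :
  \int[P]_w (u (lab w))%:E = (\sum_c u c * fine (P (lab @^-1` [set c])))%:E.
Proof.
pose g c w : \bar R := (u c)%:E * (\1_(lab @^-1` [set c]) w)%:E.
transitivity (\int[P]_w \sum_c g c w).
  apply: eq_integral => w _; rewrite (bigD1 (lab w))//= /g indicE mem_set// mule1.
  rewrite big1 ?adde0// => c cw.
  by rewrite indicE memNset ?mule0// => /= labE; rewrite labE eqxx in cw.
have ig c : P.-integrable setT (g c).
  by apply: integrableZl => //; exact: integrable_indic.
rewrite integral_sum// -sumEFin; apply: eq_bigr => c _.
rewrite integralZl//; last exact: integrable_indic.
by rewrite integral_indic// setIT EFinM fineK// fin_num_measure.
Qed.

Lemma prob_label_pred (p : pred L) :
  fine (P [set w | p (lab w)]) = (\sum_(c | p c) fine (P (lab @^-1` [set c])))%R.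
Proof.
have := integral_label (fun c => (p c)%:R).
rewrite (_ : (fun w => _) = (fun w => (\1_[set w | p (lab w)] w)%:E)).
  rewrite integral_indic ?setIT//; last exact: measurable_label_pred.
  move=> -> /=; rewrite [RHS]big_mkcond; apply: eq_bigr => c _.
  by case: (p c); rewrite ?mul1r ?mul0r.
by apply/funext => w; rewrite indicE; congr ((nat_of_bool _)%:R%:E);
  apply/idP/idP; rewrite inE.
Qed.

Lemma integral_label_perturbed (u : L -> R) (K : R) (bad : set T) : measurable bad ->
  \int[P]_w (u (lab w) + K * \1_bad w)%:E =
  ((\sum_c u c * fine (P (lab @^-1` [set c]))) + K * fine (P bad))%:E.
Proof.
move=> mbad; under eq_integral do rewrite EFinD EFinM.
have ibad : P.-integrable setT (EFin \o \1_bad) by exact: integrable_indic.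
rewrite integralD//; [|exact: integrable_label|exact: integrableZl].
rewrite integral_label integralZl// integral_indic// setIT.
by rewrite EFinD EFinM fineK// fin_num_measure.
Qed.

Lemma integral_label_sandwich (g : T -> R) (u v : L -> R) (K : R)
    (bad : set T) : measurable bad ->
  (forall w, v (lab w) - K * \1_bad w <= g w <= u (lab w) + K * \1_bad w)%R ->
  \int[P]_w (g w)%:E \is a fin_num /\
  ((\sum_c v c * fine (P (lab @^-1` [set c]))) - K * fine (P bad) <=
   fine (\int[P]_w (g w)%:E) <=
   (\sum_c u c * fine (P (lab @^-1` [set c]))) + K * fine (P bad))%R.
Proof.
move=> mbad vgu.
have ub : \int[P]_w (g w)%:E <= \int[P]_w (u (lab w) + K * \1_bad w)%:E.
  by apply: le_integral_pointwise => w; rewrite lee_fin; have /andP[] := vgu w.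
have lb : \int[P]_w (v (lab w) + - K * \1_bad w)%:E <= \int[P]_w (g w)%:E.
  by apply: le_integral_pointwise => w; rewrite lee_fin mulNr; have /andP[] := vgu w.
rewrite !integral_label_perturbed// mulNr in ub lb.
case: (\int[P]_w (g w)%:E) ub lb => [r| |]; rewrite ?leye_eq ?leeNy_eq//=.
by rewrite !lee_fin => -> ->.
Qed.

End finite_labels.

Section weak_convergence.
Variable R : realType.
Context d (Omega : measurableType d) (P : probability Omega R)
  (Z : nat -> Omega -> R -> R).
Context d' (Omega' : measurableType d') (Q : probability Omega' R)
  (S : Omega' -> R -> R).

Record cell_approximation (del : R) := CellApproximation {
  cell_index : finType;
  cell : cell_index -> set (R -> R);
  label : nat -> Omega -> cell_index;
  limit_label : Omega' -> cell_index;
  bad : nat -> set Omega;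
  limit_bad : set Omega';
  cell_cadlag : forall c x, cell c x -> cadlag x;
  cell_close : forall c x y, cell c x -> cell c y -> J1_close del x y;
  measurable_label : forall n c, measurable (label n @^-1` [set c]);
  measurable_limit_label : forall c, measurable (limit_label @^-1` [set c]);
  label_cvg : forall c, fine (P (label n @^-1` [set c])) @[n --> \oo] -->
    fine (Q (limit_label @^-1` [set c]));
  measurable_bad : forall n, measurable (bad n);
  measurable_limit_bad : measurable limit_bad;
  near_bad_le : \forall n \near \oo, (P (bad n) <= del%:E)%E;
  limit_bad_le : (Q limit_bad <= del%:E)%E;
  near_label_cell : \forall n \near \oo, forall w, ~ bad n w -> cell (label n w) (Z n w);
  limit_label_cell : forall w, ~ limit_bad w -> cell (limit_label w) (S w)
}.

Section oscillation.
Variables (f : (R -> R) -> R) (M del : R) (A : cell_approximation del).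
Hypothesis f_le : forall x, `|f x| <= M.
Hypothesis del_gt0 : 0 < del.

Definition cell_sup (c : cell_index A) : R := sup (f @` cell c).
Definition cell_inf (c : cell_index A) : R := inf (f @` cell c).
Definition oscillation (w : Omega') : R :=
  cell_sup (limit_label A w) - cell_inf (limit_label A w).

Let f_bounds x : - M <= f x <= M. Proof. by rewrite -ler_norml. Qed.

Let M_ge0 : 0 <= M. Proof. by apply: le_trans (f_le (cst 0)). Qed.

Let has_ubound_cell c : has_ubound (f @` @cell _ A c).
Proof. by exists M => _ [x _ <-]; have /andP[] := f_bounds x. Qed.

Let has_lbound_cell c : has_lbound (f @` @cell _ A c).
Proof. by exists (- M) => _ [x _ <-]; have /andP[] := f_bounds x. Qed.

Lemma cell_inf_le_sup c x : cell c x -> cell_inf c <= f x <= cell_sup c.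
Proof.
by move=> cx; apply/andP; split; [apply: ge_inf|apply: ub_le_sup] => //; exists x.
Qed.

Lemma cell_inf_sup_bounds c : [/\ - M <= cell_inf c, cell_inf c <= cell_sup c &
  cell_sup c <= M].
Proof.
have [fc0|/set0P[_ [x cx _]]] := eqVneq (f @` cell c) set0.
  by rewrite /cell_inf /cell_sup fc0 inf0 sup0 oppr_le0.
have fc0 : f @` cell c !=set0 by exists (f x); exists x.
have /andP[inf_f f_sup] := cell_inf_le_sup cx; split.
- by apply: lb_le_inf => // _ [y _ <-]; have /andP[] := f_bounds y.
- exact: le_trans f_sup.
- by apply: ge_sup => // _ [y _ <-]; have /andP[] := f_bounds y.
Qed.

Lemma oscillation_bounds w : 0 <= oscillation w <= 2 * M.
Proof. by have [] := cell_inf_sup_bounds (limit_label A w); rewrite /oscillation; lra. Qed.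

Lemma measurable_oscillation : measurable_fun setT oscillation.
Proof.
exact: (measurable_label_fun (@measurable_limit_label _ A)
  (fun c => cell_sup c - cell_inf c)).
Qed.

Lemma oscillation_witness w : ~ limit_bad A w -> exists x y,
  [/\ cell (limit_label A w) x, cell (limit_label A w) y &
      oscillation w <= f x - f y + del].
Proof.
move=> /limit_label_cell Sw.
have fc0 : f @` cell (limit_label A w) !=set0 by exists (f (S w)); exists (S w).
have del20 : 0 < del / 2 by rewrite divr_gt0.
have [_ [x cx <-] x_sup] := sup_adherent del20 (conj fc0 (has_ubound_cell _)).
have [_ [y cy <-] y_inf] := inf_adherent del20 (conj fc0 (has_lbound_cell _)).
exists x, y; split=> //; move: x_sup y_inf.
by rewrite /oscillation /cell_sup /cell_inf; lra.
Qed.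

Let sandwich (T : Type) (w : T) (B : set T) c x : (~ B w -> cell c x) ->
  cell_inf c - 2 * M * \1_B w <= f x <= cell_sup c + 2 * M * \1_B w.
Proof.
rewrite indicE; have [Bw _|nBw /(_ nBw)/cell_inf_le_sup] := pselect (B w).
  rewrite mem_set// mulr1.
  by have := f_bounds x; have [] := cell_inf_sup_bounds c; lra.
by rewrite memNset// mulr0 subr0 addr0.
Qed.

Let prob_le d0 (T : measurableType d0) (Pr : probability T R) (E : set T) :
  measurable E -> (Pr E <= del%:E)%E -> fine (Pr E) <= del.
Proof. by move=> mE E_le; rewrite -lee_fin fineK// fin_num_measure. Qed.

Lemma integral_near_limit :
  (\int[Q]_w (f (S w))%:E)%E \is a fin_num /\
  \forall n \near \oo, (\int[P]_w (f (Z n w))%:E)%E \is a fin_num /\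
    `|fine (\int[P]_w (f (Z n w))%:E)%E - fine (\int[Q]_w (f (S w))%:E)%E| <=
    fine (\int[Q]_w (oscillation w)%:E)%E + (4 * M + 1) * del.
Proof.
have [fin_limit limit_sandwich] := @integral_label_sandwich _ _ _ Q _ _
  (@measurable_limit_label _ A) (f \o S) cell_sup cell_inf (2 * M) _
  (measurable_limit_bad A) (fun w => sandwich (limit_label_cell (w := w))).
split=> //.
have label_sum_cvg u : \forall n \near \oo,
    `|\sum_c u c * fine (Q (limit_label A @^-1` [set c])) -
      \sum_c u c * fine (P (label A n @^-1` [set c]))| <= del.
  have /cvgrPdist_le : \sum_c u c * fine (P (label A n @^-1` [set c]))
      @[n --> \oo] --> \sum_c u c * fine (Q (limit_label A @^-1` [set c])).
    apply: cvg_big => [|c _]; first exact: add_continuous.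
    by apply: cvgM; [exact: cvg_cst|exact: label_cvg].
  exact.
have oscillationE : fine (\int[Q]_w (oscillation w)%:E)%E =
    \sum_c cell_sup c * fine (Q (limit_label A @^-1` [set c])) -
    \sum_c cell_inf c * fine (Q (limit_label A @^-1` [set c])).
  rewrite (integral_label Q (@measurable_limit_label _ A)
    (fun c => cell_sup c - cell_inf c)) /= -sumrB.
  by apply: eq_bigr => c _; rewrite mulrBl.
near=> n.
have cell_n w : ~ bad A n w -> cell (label A n w) (Z n w).
  by move: w; near: n; exact: near_label_cell.
have [fin_n n_sandwich] := @integral_label_sandwich _ _ _ P _ _
  (@measurable_label _ A n) (f \o Z n) cell_sup cell_inf (2 * M) _
  (@measurable_bad _ A n) (fun w => sandwich (cell_n w)).
split=> //.
have bad_n : fine (P (bad A n)) <= del.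
  by apply: prob_le; [exact: measurable_bad|near: n; exact: near_bad_le].
have bad_limit := prob_le (measurable_limit_bad A) (limit_bad_le A).
have sup_n : `|\sum_c cell_sup c * fine (Q (limit_label A @^-1` [set c])) -
    \sum_c cell_sup c * fine (P (label A n @^-1` [set c]))| <= del.
  by near: n; exact: label_sum_cvg.
have inf_n : `|\sum_c cell_inf c * fine (Q (limit_label A @^-1` [set c])) -
    \sum_c cell_inf c * fine (P (label A n @^-1` [set c]))| <= del.
  by near: n; exact: label_sum_cvg.
have := ler_wpM2l M_ge0 bad_n; have := ler_wpM2l M_ge0 bad_limit.
move: limit_sandwich n_sandwich sup_n inf_n.
by rewrite oscillationE !ler_norml; lra.
Unshelve. all: by end_near. Qed.

End oscillation.

Section diagonal.
Variables (f : (R -> R) -> R) (M : R) (del : nat -> R).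
Variable A : forall k, cell_approximation (del k).
Hypothesis f_le : forall x, `|f x| <= M.
Hypothesis f_continuous : J1_continuous f.
Hypothesis del_gt0 : forall k, 0 < del k.
Hypothesis del_cvg0 : del k @[k --> \oo] --> 0.

Lemma oscillation_cvg0 w : (\forall k \near \oo, ~ limit_bad (A k) w) ->
  oscillation f (A k) w @[k --> \oo] --> 0.
Proof.
move=> good.
have S_cadlag : cadlag (S w).
  by have [k /limit_label_cell/cell_cadlag] := filter_ex good.
have /choice[xy xyP] k : exists xy : (R -> R) * (R -> R),
    [/\ cadlag xy.1, cadlag xy.2 & ~ limit_bad (A k) w ->
      [/\ J1_close (del k) (S w) xy.1, J1_close (del k) (S w) xy.2 &
          oscillation f (A k) w <= f xy.1 - f xy.2 + del k]].
  have [b|nb] := pselect (limit_bad (A k) w); first by exists (S w, S w).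
  have [x [y [cx cy osc_le]]] := oscillation_witness f_le (del_gt0 k) nb.
  exists (x, y); split=> /= [||_]; [exact: cell_cadlag cx|exact: cell_cadlag cy|].
  by split=> //; [apply: cell_close cx|apply: cell_close cy]; exact: limit_label_cell.
have fx : f (xy k).1 @[k --> \oo] --> f (S w).
  apply: (f_continuous (xs := fun k => (xy k).1)) => // [k|]; first by case: (xyP k).
  apply: (J1_cvg_of_close del_gt0 del_cvg0).
  by apply: filterS good => k; case: (xyP k) => _ _ /[apply] -[].
have fy : f (xy k).2 @[k --> \oo] --> f (S w).
  apply: (f_continuous (xs := fun k => (xy k).2)) => // [k|]; first by case: (xyP k).
  apply: (J1_cvg_of_close del_gt0 del_cvg0).
  by apply: filterS good => k; case: (xyP k) => _ _ /[apply] -[].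
have bound_cvg0 : f (xy k).1 - f (xy k).2 + del k @[k --> \oo] --> 0.
  have -> : (0 : R) = f (S w) - f (S w) + 0 by rewrite subrr addr0.
  by apply: cvgD => //; exact: cvgB.
apply: (squeeze_cvgr (f := cst 0) _ _ bound_cvg0); last exact: cvg_cst.
apply: filterS good => k nb; have /andP[-> _] := oscillation_bounds (A k) f_le w.
by have [_ _ /(_ nb)[_ _ ->]] := xyP k.
Qed.

Lemma integral_oscillation_cvg0 :
  {ae Q, forall w, \forall k \near \oo, ~ limit_bad (A k) w} ->
  fine (\int[Q]_w (oscillation f (A k) w)%:E)%E @[k --> \oo] --> 0.
Proof.
move=> good; apply: (@fine_cvg _ _ _ _ _ 0).
have [|||||_ _] := @dominated_convergence _ _ _ Q setT measurableT
  (fun k w => (oscillation f (A k) w)%:E) (cst 0%E) (cst (2 * M)%:E).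
- by move=> k; apply/measurable_EFinP; exact: measurable_oscillation.
- exact: measurable_cst.
- apply: filterS good => w /oscillation_cvg0 osc0 _.
  by apply: cvg_EFin => //; exact: nearW.
- exact: (@finite_measure_integrable_cst _ _ _ Q setT (2 * M)).
- apply: aeW => w k _ /=; have /andP[osc0 osc2M] := oscillation_bounds (A k) f_le w.
  by rewrite lee_fin ger0_norm.
- by rewrite integral0.
Qed.

Lemma integral_cvg : {ae Q, forall w, \forall k \near \oo, ~ limit_bad (A k) w} ->
  (\int[P]_w (f (Z n w))%:E)%E @[n --> \oo] --> (\int[Q]_w (f (S w))%:E)%E.
Proof.
move=> /integral_oscillation_cvg0 osc0.
have [fin_limit _] := integral_near_limit (A 0%N) f_le (del_gt0 0%N).
rewrite -(fineK fin_limit); apply/fine_cvgP; split.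
  by have [_] := integral_near_limit (A 0%N) f_le (del_gt0 0%N); apply: filterS => n [].
apply/cvgrPdist_le => e e0.
have bound_cvg0 : fine (\int[Q]_w (oscillation f (A k) w)%:E)%E + (4 * M + 1) * del k
    @[k --> \oo] --> 0.
  have -> : (0 : R) = 0 + (4 * M + 1) * 0 by rewrite mulr0 addr0.
  by apply: cvgD => //; apply: cvgM => //; exact: cvg_cst.
have [k bound_k] := filter_ex (cvgr_le _ bound_cvg0 _ e0).
have [_] := integral_near_limit (A k) f_le (del_gt0 k); apply: filterS => n [_ near_n].
by rewrite distrC (le_trans near_n).
Qed.

End diagonal.

Lemma D_weak_cvg_of_cells :
  (forall del, 0 < del -> $| cell_approximation del|) -> D_weak_cvg P Z Q S.
Proof.
move=> cells f [M f_le] f_continuous.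
pose A k := unsquash (cells _ (@half_pow_gt0 R k)).
apply: (integral_cvg (A := A) f_le f_continuous (@half_pow_gt0 R) (@half_pow_cvg0 R)).
by apply: ae_near_notin_half_pow => k; [exact: measurable_limit_bad|exact: limit_bad_le].
Qed.

End weak_convergence.

(** * Point configurations and their labels *)

Section configurations.
Variable R : realType.
Implicit Types (h e y T : R) (t : nat -> R) (j : nat -> \bar R) (z : R -> R).

(* On [0, T[, z is within e of the running maximum of 0 and the marks. *)
Definition tracks T e t j z := forall u, 0 <= u < T ->
  [/\ - e <= z u, (forall k, t k <= u -> (j k <= (z u + e)%:E)%E) &
    z u <= e \/ exists2 k, t k <= u & ((z u - e)%:E <= j k)%E].

Definition no_point_above h t j (a : nat) y :=
  forall k, in_column h a (t k) -> (j k <= y%:E)%E.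

Definition column_label h e (B : nat) t j (a : nat) : nat :=
  find (fun b => `[< no_point_above h t j a (b.+1%:R * e) >]) (iota 0 B).

Lemma column_label_lt h e B t j a b : 0 < e -> (0 < b <= B)%N ->
  (column_label h e B t j a < b)%N = `[< no_point_above h t j a (b%:R * e) >].
Proof.
case: b => // b e0 bB; rewrite ltnS; apply/idP/idP => [lb|nb]; last first.
  rewrite leqNgt; apply/negP => /(before_find 0%N).
  by rewrite nth_iota// add0n nb.
have : has (fun b => `[< no_point_above h t j a (b.+1%:R * e) >]) (iota 0 B).
  by rewrite has_find size_iota (leq_ltn_trans lb).
move=> /(nth_find 0%N); rewrite nth_iota ?(leq_ltn_trans lb)// add0n => /asboolP nl.
apply/asboolP => k /nl/le_trans; apply.
by rewrite lee_fin ler_pM2r// ler_nat ltnS.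
Qed.

Lemma column_label_le h e B t j a : (column_label h e B t j a <= B)%N.
Proof. by rewrite -[leqRHS](size_iota 0) find_size. Qed.

Definition regular_configuration h (A : nat) e (B : nat) t j :=
  [/\ forall k, t k <= 0 -> (j k <= e%:E)%E,
      forall a k k', (a < A)%N -> in_column h a (t k) -> in_column h a (t k') ->
        (e%:E < j k)%E -> (e%:E < j k')%E -> t k = t k' &
      forall a, (a < A)%N -> no_point_above h t j a (B%:R * e)].

Section regular_configuration.
Variables (h e : R) (A B : nat) (t : nat -> R) (j : nat -> \bar R).
Hypotheses (h_gt0 : 0 < h) (e_gt0 : 0 < e) (B_gt0 : (0 < B)%N).
Hypothesis regular : regular_configuration h A e B t j.

Let label := column_label h e B t j.

Let label_lt a : (a < A)%N -> (label a < B)%N.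
Proof.
case: regular => _ _ bounded aA; rewrite column_label_lt ?B_gt0 ?leqnn//.
by apply/asboolP; exact: bounded.
Qed.

Let label_upper a k : (a < A)%N -> in_column h a (t k) ->
  (j k <= ((label a).+1%:R * e)%:E)%E.
Proof.
move=> aA; have := ltnSn (label a).
by rewrite {1}/label column_label_lt ?label_lt// => /asboolP; exact.
Qed.

Let label_lower a : (a < A)%N -> (0 < label a)%N ->
  exists2 k, in_column h a (t k) & (((label a)%:R * e)%:E < j k)%E.
Proof.
move=> aA label0; have := ltnn (label a).
rewrite {1}/label column_label_lt// ?label0 ?(ltnW (label_lt aA))//.
move=> /asboolPn/existsNP[k] /not_implyP[ka /negP].
by rewrite -ltNge; exists k.
Qed.

Definition jump_time (a : nat) : R :=
  if a isn't a'.+1 then 0 else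
  if pselect (exists k, in_column h a' (t k) /\ (e%:E < j k)%E) is left large
  then t (projT1 (cid large)) else a'%:R * h + h / 2.

Lemma jump_time_column a : in_column h a (jump_time a.+1).
Proof.
rewrite /jump_time; case: pselect => [?|_]; first by case: cid => ? [].
by have := h_gt0; rewrite /in_column -[a.+1%:R]natr1 => ?; apply/andP; split; lra.
Qed.

Lemma jump_timeE a k : (a < A)%N -> in_column h a (t k) -> (e%:E < j k)%E ->
  t k = jump_time a.+1.
Proof.
case: regular => _ lonely _ aA ka kj; rewrite /jump_time.
case: pselect => [?|[]]; last by exists k.
by case: cid => k' /= [k'a k'j]; exact: (lonely a).
Qed.

Lemma increasing_jump_time : increasing_seq jump_time.
Proof.
apply/increasing_seqP => -[|a]; last first.
  have /andP[_] := jump_time_column a; have /andP[+ _] := jump_time_column a.+1.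
  by move=> le lt; exact: lt_le_trans le.
rewrite /jump_time; case: pselect => [?|_]; last by rewrite mul0r add0r divr_gt0.
case: cid => k /= [_ kj]; rewrite ltNge; apply/negP.
by case: regular => early _ _ /early; rewrite leNgt kj.
Qed.

Lemma running_height_ge0 (c : nat -> nat) a : 0 <= running_height e c a.
Proof. by rewrite mulr_ge0// ltW. Qed.

Lemma tracks_lower z a u : (a <= A)%N -> tracks (A%:R * h) e t j z ->
  0 <= u < A%:R * h -> jump_time a <= u -> running_height e label a - e <= z u.
Proof.
move=> aA tr /tr[z_ge marks_le _] au; rewrite /running_height.
case: a => [|a] in aA au *; first by rewrite big_ord0 mul0r sub0r.
have [|i ->] := @bigop.eq_bigmax _ (fun i : 'I_a.+1 => label i); first by rewrite card_ord.
have [->|label0] := posnP (label i); first by rewrite mul0r sub0r.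
have iA : (i < A)%N by exact: leq_trans aA.
have [k ki kj] := label_lower iA label0.
have /marks_le : t k <= u.
  rewrite (jump_timeE iA ki) ?(le_trans _ au) ?increasing_jump_time//.
  by rewrite (le_lt_trans _ kj)// lee_fin ler_peMl ?ler1n// ltW.
by move=> /(lt_le_trans kj); rewrite lte_fin; lra.
Qed.

Lemma tracks_upper z a u : tracks (A%:R * h) e t j z ->
  0 <= u < A%:R * h -> u < jump_time a.+1 -> z u <= running_height e label a + 2 * e.
Proof.
move=> tr uA ua; have e0 := e_gt0; have [_ _ [ze|[k ku kz]]] := tr _ uA.
  by have := running_height_ge0 label a; lra.
have [je|ej] := leP (j k) e%:E.
  by have := le_trans kz je; rewrite lee_fin; have := running_height_ge0 label a; lra.
have k0 : 0 < t k.
  by rewrite ltNge; apply/negP; case: regular => early _ _ /early; rewrite leNgt ej.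
have [|i iA ki] := @ex_in_column R h A (t k) h_gt0.
  by have /andP[_ uT] := uA; rewrite ltW ?(le_lt_trans ku).
have ia : (i < a)%N.
  have : jump_time i.+1 < jump_time a.+1 by rewrite -(jump_timeE iA ki) ?(le_lt_trans ku).
  by rewrite (leW_mono increasing_jump_time).
have := le_trans kz (label_upper iA ki).
have : (label i)%:R * e <= running_height e label a.
  rewrite ler_pM2r// ler_nat.
  exact: (@leq_bigmax _ (fun i : 'I_a => label i) (Ordinal ia)).
by rewrite lee_fin -natr1 mulrDl mul1r; lra.
Qed.

Lemma tracks_step_cell z : tracks (A%:R * h) e t j z ->
  step_cell h A e (column_label h e B t j) z.
Proof.
move=> tr; exists jump_time; split=> //.
- exact: increasing_jump_time.
- exact: jump_time_column.
- move=> a u aA /andP[au ua].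
  have uA : 0 <= u < A%:R * h.
    apply/andP; split; first by apply: le_trans au; rewrite -[0]/(jump_time 0)
      increasing_jump_time.
    apply: (lt_le_trans ua); have /andP[_ /ltW/le_trans] := jump_time_column a.
    by apply; rewrite ler_pM2r// ler_nat.
  have := tracks_lower (ltnW aA) tr uA au; have := tracks_upper tr uA ua.
  by rewrite ler_norml; lra.
Qed.

End regular_configuration.

End configurations.

Lemma probU_le (R : realType) d (T : measurableType d) (P : probability T R)
    (A B : set T) (a b : R) : measurable A -> measurable B ->
  (P A <= a%:E)%E -> (P B <= b%:E)%E -> (P (A `|` B) <= (a + b)%:E)%E.
Proof.
move=> mA mB Aa Bb; apply: (@le_trans _ _ (P A + P B)%E); first exact: measureU2.
by rewrite EFinD leeD.
Qed.

Lemma prob_bigcup_le (R : realType) d (T : measurableType d) (P : probability T R)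
    (n : nat) (F : nat -> set T) (r : R) : (forall k, measurable (F k)) ->
  (forall k, (k < n)%N -> (P (F k) <= r%:E)%E) ->
  (P (\bigcup_(k < n) F k) <= (n%:R * r)%:E)%E.
Proof.
move=> mF Fr; rewrite bigcup_mkord.
apply: (@le_trans _ _ (\sum_(k < n) P (F k))%E); first exact: Boole_inequality.
apply: (@le_trans _ _ (\sum_(k < n) r%:E)%E).
  by apply: lee_sum => k _; exact: Fr.
by rewrite sumEFin sumr_const card_ord mulr_natl.
Qed.

Section configuration_events.
Variable R : realType.
Context d (Omega : measurableType d).
Variables (t : nat -> Omega -> R) (j : nat -> Omega -> \bar R).
Implicit Types (h e : R) (A B : nat).

Definition large_point h e a k : set Omega :=
  [set w | in_column h a (t k w) /\ (e%:E < j k w)%E].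

Definition early_point e : set Omega :=
  \bigcup_k [set w | t k w <= 0 /\ (e%:E < j k w)%E].

Definition crowded_column h e a : set Omega :=
  \bigcup_k \bigcup_(k' in [set k' | (k < k')%N])
    (large_point h e a k `&` large_point h e a k').

Definition void_columns h A (D : pred 'I_A) (y : 'I_A -> R) : set Omega :=
  [set w | forall a, D a -> no_point_above h (t^~ w) (j^~ w) a (y a)].

Definition irregular h A e B : set Omega :=
  early_point e `|` (\bigcup_(a < A) crowded_column h e a `|`
    ~` void_columns h (xpredT : pred 'I_A) (fun=> B%:R * e)).

Hypothesis measurable_t : forall k, measurable_fun setT (t k).
Hypothesis measurable_j : forall k, measurable_fun setT (j k).

Let measurable_time k (I : interval R) : measurable [set w | t k w \in I].
Proof.
rewrite -[X in measurable X]setTI.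
exact: (measurable_t k measurableT (measurable_itv I)).
Qed.

Let measurable_mark k y : measurable [set w | (y%:E < j k w)%E].
Proof.
rewrite -[X in measurable X]setTI.
exact: (emeasurable_fun_o_infty measurableT (measurable_j k)).
Qed.

Lemma measurable_large_point h e a k : measurable (large_point h e a k).
Proof. exact: (measurableI _ _ (measurable_time k `[_, _[) (measurable_mark k e)). Qed.

Lemma measurable_early_point e : measurable (early_point e).
Proof.
apply: bigcup_measurable => k _.
exact: (measurableI _ _ (measurable_time k `]-oo, 0]) (measurable_mark k e)).
Qed.

Lemma measurable_crowded_column h e a : measurable (crowded_column h e a).
Proof.
apply: bigcup_measurable => k _; apply: bigcup_measurable => k' _.
by apply: measurableI; exact: measurable_large_point.
Qed.

Lemma no_point_aboveE h a y : [set w | no_point_above h (t^~ w) (j^~ w) a y] =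
  \bigcap_k ~` large_point h y a k.
Proof.
apply/seteqP; split=> w /= above k.
  by move=> _ [ka]; apply/negP; rewrite -leNgt; exact: above.
by move=> ka; rewrite leNgt; apply/negP => kj; exact: (above k).
Qed.

Lemma measurable_no_point_above h a y :
  measurable [set w | no_point_above h (t^~ w) (j^~ w) a y].
Proof.
rewrite no_point_aboveE; apply: bigcapT_measurable => k.
exact/measurableC/measurable_large_point.
Qed.

Lemma measurable_void_columns h A (D : pred 'I_A) (y : 'I_A -> R) :
  measurable (void_columns h D y).
Proof.
apply: (@fin_bigcap_measurable _ _ _ [set a | D a]
  (fun a : 'I_A => [set w | no_point_above h (t^~ w) (j^~ w) a (y a)])).
  exact: finite_finset.
by move=> a _; exact: measurable_no_point_above.
Qed.

Lemma measurable_irregular h A e B : measurable (irregular h A e B).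
Proof.
apply: measurableU; first exact: measurable_early_point.
apply: measurableU; last exact/measurableC/measurable_void_columns.
by apply: bigcup_measurable => a _; exact: measurable_crowded_column.
Qed.

Lemma regular_of_not_irregular h A e B w : ~ irregular h A e B w ->
  regular_configuration h A e B (t^~ w) (j^~ w).
Proof.
move=> /not_orP[no_early] /not_orP[no_crowd /contrapT low]; split.
- by move=> k tk; rewrite leNgt; apply/negP => kj; apply: no_early; exists k.
- move=> a k k' aA ka k'a kj k'j; apply: contrapT => tkk'; apply: no_crowd.
  exists a => //; have [kk'|kk'|kk'] := ltngtP k k'; last by rewrite kk' in tkk'.
    by exists k => //; exists k'.
  by exists k' => //; exists k.
- by move=> a aA; exact: (low (Ordinal aA)).
Qed.

Lemma irregular_le (P : probability Omega R) h A e B (p q r : R) :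
  (P (early_point e) <= p%:E)%E ->
  (forall a, (a < A)%N -> (P (crowded_column h e a) <= q%:E)%E) ->
  1 - r <= fine (P (void_columns h (xpredT : pred 'I_A) (fun=> B%:R * e))) ->
  (P (irregular h A e B) <= (p + (A%:R * q + r))%:E)%E.
Proof.
move=> early_le crowded_le void_ge.
have mcrowded a : measurable (crowded_column h e a).
  exact: measurable_crowded_column.
have mvoid := measurable_void_columns h (xpredT : pred 'I_A) (fun=> B%:R * e).
have mcrowd : measurable (\bigcup_(a < A) crowded_column h e a).
  exact: bigcup_measurable.
apply: probU_le => //; first exact: measurable_early_point.
  by apply: measurableU => //; exact: measurableC.
apply: probU_le => //; first exact: measurableC.
  exact: prob_bigcup_le.
rewrite probability_setC// -[P (void_columns _ _ _)]fineK ?fin_num_measure//.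
by rewrite -EFinB lee_fin; lra.
Qed.

Section labels.
Variables (h e : R) (A B : nat).
Hypothesis e_gt0 : 0 < e.

Definition configuration_label (w : Omega) : {ffun 'I_A -> 'I_B.+1} :=
  [ffun a : 'I_A => inord (column_label h e B (t^~ w) (j^~ w) a)].

Lemma configuration_labelE w a :
  configuration_label w a = column_label h e B (t^~ w) (j^~ w) a :> nat.
Proof. by rewrite ffunE inordK// ltnS column_label_le. Qed.

Lemma configuration_label_ltE a b : [set w | (configuration_label w a < b)%N] =
  if (b == 0)%N then set0 else if (b <= B)%N then
  [set w | no_point_above h (t^~ w) (j^~ w) a (b%:R * e)] else setT.
Proof.
case: posnP => [->|b0]; first by apply/seteqP; split.
case: leqP => bB; apply/seteqP; split=> w //=.
- by rewrite configuration_labelE column_label_lt ?b0// => /asboolP.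
- by move=> ?; rewrite configuration_labelE column_label_lt ?b0//; exact/asboolP.
- by move=> _; rewrite (leq_trans (ltn_ord _)).
Qed.

Lemma void_columns_label (c : {ffun 'I_A -> 'I_B.+1}) :
  void_columns h (fun a => (c a < B)%N) (fun a => (c a).+1%:R * e) =
  [set w | [forall a, configuration_label w a <= c a]%N].
Proof.
apply/seteqP; split => w /= label_le.
  apply/forallP => a; have [cB|cB] := ltnP (c a) B; last first.
    by rewrite (leq_trans _ cB)// -ltnS.
  by rewrite configuration_labelE -ltnS column_label_lt//; apply/asboolP; exact: label_le.
move=> a ca; move/forallP : label_le => /(_ a).
by rewrite configuration_labelE -ltnS column_label_lt// => /asboolP.
Qed.

Lemma measurable_configuration_label c : measurable (configuration_label @^-1` [set c]).
Proof.
have mlt (a : 'I_A) b : measurable [set w | (configuration_label w a < b)%N].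
  rewrite configuration_label_ltE; case: ifP => // _; case: ifP => // _.
  exact: measurable_no_point_above.
rewrite (_ : _ @^-1` _ = \bigcap_(a in setT)
    ([set w | (configuration_label w a < (c a).+1)%N] `\`
     [set w | (configuration_label w a < c a)%N])).
  by apply: fin_bigcap_measurable => [|a _]; [exact: finite_finset|exact: measurableD].
apply/seteqP; split => w /= => [<- a _|label_c]; first by split; rewrite /= ?ltnSn ?ltnn.
apply/ffunP => a; apply/val_inj/eqP; have [/= le /negP] := label_c a I.
by rewrite -leqNgt => ge; rewrite eqn_leq ge andbT -ltnS.
Qed.

Lemma prob_void_columns (P : probability Omega R) (c : {ffun 'I_A -> 'I_B.+1}) :
  fine (P (void_columns h (fun a => (c a < B)%N) (fun a => (c a).+1%:R * e))) =
  \sum_(c' : {ffun 'I_A -> 'I_B.+1} | [forall a, c' a <= c a]%N)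
    fine (P (configuration_label @^-1` [set c'])).
Proof.
rewrite void_columns_label.
exact: (prob_label_pred P measurable_configuration_label
  (fun c' : {ffun 'I_A -> 'I_B.+1} => [forall a, c' a <= c a]%N)).
Qed.

End labels.

End configuration_events.

(* The point masses are recovered from the lower-orthant masses by induction on
   the sum of the coordinates. *)
Lemma orthant_cvg (R : realType) (A B : nat)
    (p : nat -> {ffun 'I_A -> 'I_B} -> R) (q : {ffun 'I_A -> 'I_B} -> R) :
  (forall c : {ffun 'I_A -> 'I_B},
    \sum_(c' : {ffun 'I_A -> 'I_B} | [forall a, c' a <= c a]%N) p n c' @[n --> \oo] -->
    \sum_(c' : {ffun 'I_A -> 'I_B} | [forall a, c' a <= c a]%N) q c') ->
  forall c, p n c @[n --> \oo] --> q c.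
Proof.
move=> sum_cvg c; have [m] := ubnP (\sum_a c a)%N.
elim: m c => // m IH c cm.
pose below (g : {ffun 'I_A -> 'I_B} -> R) :=
  \sum_(c' : {ffun 'I_A -> 'I_B} | [forall a, c' a <= c a]%N && (c' != c)) g c'.
have below_cvg : below (p n) @[n --> \oo] --> below q.
  apply: cvg_big; first exact: add_continuous.
  move=> c' /andP[/forallP le ne]; apply: IH; apply: leq_trans _ (ltnSE cm).
  have [a ca] : exists a, c' a != c a.
    apply/existsP; rewrite -negb_forall; apply: contra ne => /forallP cc'.
    by apply/eqP/ffunP => a; exact/eqP.
  rewrite (bigD1 a)//= [ltnRHS](bigD1 a)//= -addSn leq_add//.
    by rewrite ltn_neqAle ca le.
  by apply: leq_sum => i _; exact: le.
have belowE g : g c =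
    \sum_(c' : {ffun 'I_A -> 'I_B} | [forall a, c' a <= c a]%N) g c' - below g.
  by rewrite (bigD1 c)/= ?addrK//; apply/forallP.
rewrite (belowE q); under eq_fun do rewrite belowE.
by apply: cvgB; [exact: sum_cvg|exact: below_cvg].
Qed.

(** * Convergence to the running maximum of a Poisson configuration *)

Section poisson_like_configurations.
Variables (R : realType) (alpha : R).

(* The limiting Poisson configuration is covered as well, as a constant sequence. *)
Definition asymptotically_poisson {d} {Omega : measurableType d} (P : probability Omega R)
    (t : nat -> nat -> Omega -> R) (j : nat -> nat -> Omega -> \bar R) : Prop :=
  [/\ forall n k, measurable_fun setT (t n k), forall n k, measurable_fun setT (j n k),
      forall h A (D : pred 'I_A) (y : 'I_A -> R), 0 < h -> (forall a, 0 < y a) ->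
        fine (P (void_columns (t n) (j n) h D y)) @[n --> \oo] -->
        expR (- \sum_(a | D a) h * y a `^ (- alpha)),
      forall h e a, 0 < h -> 0 < e -> \forall n \near \oo,
        (P (crowded_column (t n) (j n) h e a) <= ((h * e `^ (- alpha)) ^+ 2)%:E)%E &
      forall e p : R, 0 < e -> 0 < p ->
        \forall n \near \oo, (P (early_point (t n) (j n) e) <= p%:E)%E].

Definition asymptotically_tracks {d} {Omega : measurableType d} (P : probability Omega R)
    (t : nat -> nat -> Omega -> R) (j : nat -> nat -> Omega -> \bar R)
    (Z : nat -> Omega -> R -> R) : Prop :=
  forall T e H p : R, 0 < T -> 0 < e -> 0 < H -> 0 < p ->
  exists bad : nat -> set Omega, [/\ forall n, measurable (bad n),
    \forall n \near \oo, (P (bad n) <= p%:E)%E &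
    \forall n \near \oo, forall w, ~ bad n w ->
      (forall k, t n k w < T -> (j n k w <= H%:E)%E) ->
      tracks T e ((t n)^~ w) ((j n)^~ w) (Z n w)].

Lemma powRN_le (a c y : R) : 0 < a -> 0 < c -> c `^ (- a^-1) <= y -> y `^ (- a) <= c.
Proof.
move=> a0 c0 cy; have y0 : 0 < y by apply: lt_le_trans cy; exact: powR_gt0.
rewrite powRN -[leRHS]invrK lef_pV2 ?posrE ?invr_gt0 ?powR_gt0//.
have -> : c^-1 = (c `^ (- a^-1)) `^ a.
  by rewrite -powRrM mulNr mulVf ?lt0r_neq0// powR_inv1// ltW.
by apply: ge0_ler_powR; rewrite ?nnegrE ?powR_ge0// ltW.
Qed.

Lemma discretization_parameters (e del : R) : 0 < alpha -> 0 < e -> 0 < del ->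
  exists h A B, [/\ 0 < h, 2 * h <= del, del^-1 < A%:R * h, (0 < B)%N &
    A.+1%:R * (h * e `^ (- alpha)) ^+ 2 <= del / 4 /\
    A.+1%:R * (h * (B%:R * e) `^ (- alpha)) <= del / 4].
Proof.
move=> alpha0 e0 del0; set ea := e `^ (- alpha).
pose T := del^-1 + 1; have T0 : 0 < T by rewrite ltr_wpDl// invr_ge0 ltW.
have /filter_ex[A [A0 hA crowdA]] : \forall A \near \oo,
    [/\ (0 < A)%N, 2 * T / del <= A%:R & 8 * (T * ea) ^+ 2 / del <= A%:R].
  by near=> A; split; near: A; [exact: nbhs_infty_gt|exact: nbhs_infty_ger..].
have A0R : 0 < A%:R :> R by rewrite ltr0n.
have /filter_ex[B [B0 highB]] : \forall B \near \oo,
    (0 < B)%N /\ (del / (8 * T)) `^ (- alpha^-1) / e <= B%:R.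
  by near=> B; split; near: B; [exact: nbhs_infty_gt|exact: nbhs_infty_ger].
have A1 : A.+1%:R <= 2 * A%:R :> R.
  by rewrite -natrM ler_nat mul2n -addnn -addn1 leq_add2l.
exists (T / A%:R), A, B; split=> //.
- by rewrite divr_gt0.
- by rewrite mulrA ler_pdivrMr// [leRHS]mulrC -ler_pdivrMr.
- by rewrite mulrC divfK ?lt0r_neq0// ltrDl.
split; apply: (le_trans (ler_wpM2r _ A1)).
- exact: sqr_ge0.
- have -> : 2 * A%:R * (T / A%:R * ea) ^+ 2 = 2 * (T * ea) ^+ 2 / A%:R.
    by field; exact: lt0r_neq0.
  by move: crowdA; rewrite !ler_pdivrMr//; lra.
- by rewrite mulr_ge0 ?powR_ge0// divr_ge0// ltW.
- have : (B%:R * e) `^ (- alpha) <= del / (8 * T).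
    by apply: powRN_le; rewrite ?divr_gt0 ?mulr_gt0// -ler_pdivrMr.
  have -> : 2 * A%:R * (T / A%:R * (B%:R * e) `^ (- alpha)) =
      2 * T * (B%:R * e) `^ (- alpha) by field; exact: lt0r_neq0.
  move=> /(ler_wpM2l (ltW (mulr_gt0 (@ltr0n R 2) T0)))/le_trans; apply.
  by rewrite le_eqVlt; apply/orP; left; apply/eqP; field; rewrite lt0r_neq0.
Unshelve. all: by end_near. Qed.

Section step_cells.
Context d (Omega : measurableType d) (P : probability Omega R)
  (t : nat -> nat -> Omega -> R) (j : nat -> nat -> Omega -> \bar R)
  (Z : nat -> Omega -> R -> R).
Hypothesis poisson : asymptotically_poisson P t j.
Hypothesis tracking : asymptotically_tracks P t j Z.

Lemma near_step_cell (h e del : R) A B : 0 < h -> 0 < e -> 0 < del -> (0 < A)%N ->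
  (0 < B)%N -> A%:R * (h * e `^ (- alpha)) ^+ 2 <= del / 4 ->
  A%:R * (h * (B%:R * e) `^ (- alpha)) <= del / 4 ->
  exists bad : nat -> set Omega, [/\ forall n, measurable (bad n),
    \forall n \near \oo, (P (bad n) <= del%:E)%E &
    \forall n \near \oo, forall w, ~ bad n w ->
      step_cell h A e (column_label h e B ((t n)^~ w) ((j n)^~ w)) (Z n w)].
Proof.
move=> h0 e0 del0 A0 B0 crowd_small high_small.
have [mt mj void_cvg crowded_le early_le] := poisson.
have T0 : 0 < A%:R * h by rewrite mulr_gt0 ?ltr0n.
have H0 : 0 < B%:R * e by rewrite mulr_gt0 ?ltr0n.
have del8 : 0 < del / 8 by rewrite divr_gt0.
have [lost [mlost near_lost near_tracks]] := tracking T0 e0 H0 del8.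
exists (fun n => irregular (t n) (j n) h A e B `|` lost n); split.
- by move=> n; apply: measurableU => //; exact: measurable_irregular.
- have void_ge : \forall n \near \oo, 1 - (del / 4 + del / 8) <=
      fine (P (void_columns (t n) (j n) h (xpredT : pred 'I_A) (fun=> B%:R * e))).
    apply: (cvgr_ge _ (void_cvg _ _ _ _ h0 (fun=> H0))).
    rewrite sumr_const card_ord -[X in expR (- X)]mulr_natl.
    have := expR_ge1Dx (- (A%:R * (h * (B%:R * e) `^ (- alpha)))); lra.
  near=> n; apply: (@le_trans _ _ ((del / 8 + (A%:R * (h * e `^ (- alpha)) ^+ 2 +
      (del / 4 + del / 8))) + del / 8)%:E); last by rewrite lee_fin; lra.
  apply: probU_le => //; first exact: measurable_irregular.
    apply: irregular_le => //; [by near: n; exact: early_le|move=> a aA|by near: n].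
    suff : forall a : 'I_A, (P (crowded_column (t n) (j n) h e a) <=
      ((h * e `^ (- alpha)) ^+ 2)%:E)%E by move=> /(_ (Ordinal aA)).
    by near: n; apply: filter_forall => i; exact: crowded_le.
  by near: n.
- near=> n => w /not_orP[/regular_of_not_irregular reg not_lost].
  apply: tracks_step_cell => //; apply: (near near_tracks n _) => // k tkT.
  have [early _ bounded] := reg.
  have [tk0|tk0] := leP (t n k w) 0.
    by apply: (le_trans (early _ tk0)); rewrite lee_fin ler_peMl ?ler1n// ltW.
  by have [|a aA ka] := @ex_in_column _ h A (t n k w) h0; [rewrite ltW|exact: bounded ka].
Unshelve. all: by end_near. Qed.

End step_cells.

Section label_convergence.
Context d (Omega : measurableType d) (P : probability Omega R)
  (t : nat -> nat -> Omega -> R) (j : nat -> nat -> Omega -> \bar R).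
Context d' (Omega' : measurableType d') (Q : probability Omega' R)
  (t' : nat -> Omega' -> R) (j' : nat -> Omega' -> \bar R).
Hypothesis poisson : asymptotically_poisson P t j.
Hypothesis limit_poisson : asymptotically_poisson Q (fun=> t') (fun=> j').

Lemma configuration_label_cvg (h e : R) A B c : 0 < h -> 0 < e ->
  fine (P (configuration_label (t n) (j n) h e A B @^-1` [set c]))
    @[n --> \oo] --> fine (Q (configuration_label t' j' h e A B @^-1` [set c])).
Proof.
move=> h0 e0; have [mt mj void_cvg _ _] := poisson.
have [mt' mj' void_cvg' _ _] := limit_poisson.
apply: (@orthant_cvg R A B.+1
  (fun n c => fine (P (configuration_label (t n) (j n) h e A B @^-1` [set c])))
  (fun c => fine (Q (configuration_label t' j' h e A B @^-1` [set c])))) => {}c.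
rewrite -(prob_void_columns (mt' 0%N) (mj' 0%N))//.
under eq_fun do rewrite -prob_void_columns//.
have y0 a : 0 < (c a).+1%:R * e by rewrite mulr_gt0.
have := cvg_unique (@norm_hausdorff _ R^o) (cvg_cst _) (void_cvg' _ _ _ _ h0 y0).
by move=> ->; exact: void_cvg.
Qed.

End label_convergence.

Section weak_convergence_of_points.
Context d (Omega : measurableType d) (P : probability Omega R)
  (t : nat -> nat -> Omega -> R) (j : nat -> nat -> Omega -> \bar R)
  (Z : nat -> Omega -> R -> R).
Context d' (Omega' : measurableType d') (Q : probability Omega' R)
  (t' : nat -> Omega' -> R) (j' : nat -> Omega' -> \bar R) (S : Omega' -> R -> R).
Hypothesis alpha_gt0 : 0 < alpha.
Hypothesis poisson : asymptotically_poisson P t j.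
Hypothesis tracking : asymptotically_tracks P t j Z.
Hypothesis cadlag_Z : \forall n \near \oo, forall w, cadlag (Z n w).
Hypothesis limit_poisson : asymptotically_poisson Q (fun=> t') (fun=> j').
Hypothesis limit_tracking : asymptotically_tracks Q (fun=> t') (fun=> j') (fun=> S).

Lemma limit_step_cell (h e del : R) A B : 0 < h -> 0 < e -> 0 < del -> (0 < A)%N ->
  (0 < B)%N -> A%:R * (h * e `^ (- alpha)) ^+ 2 <= del / 4 ->
  A%:R * (h * (B%:R * e) `^ (- alpha)) <= del / 4 ->
  exists bad, [/\ measurable bad, (Q bad <= del%:E)%E & forall w, ~ bad w ->
    step_cell h A e (column_label h e B (t'^~ w) (j'^~ w)) (S w)].
Proof.
move=> h0 e0 del0 A0 B0 crowd_small high_small.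
have [bad [mbad near_bad near_cell]] := near_step_cell limit_poisson limit_tracking
  h0 e0 del0 A0 B0 crowd_small high_small.
by have [n [bad_n cell_n]] := filter_ex (filterI near_bad near_cell); exists (bad n).
Qed.

Lemma limit_cadlag : {ae Q, forall w, cadlag (S w)}.
Proof.
have /choice[bad badP] k : exists bad : set Omega', [/\ measurable bad,
    (Q bad <= (half_pow R k)%:E)%E & forall w, ~ bad w -> exists h A e c,
    [/\ 4 * e <= half_pow R k, (half_pow R k)^-1 < A%:R * h &
        step_cell h A.+1 e c (S w)]].
  have del0 := half_pow_gt0 R k; set del := half_pow R k in del0 *.
  have e0 : 0 < del / 4 by rewrite divr_gt0.
  have [h [A [B [h0 _ delA B0 [crowd_small high_small]]]]] :=
    discretization_parameters alpha_gt0 e0 del0.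
  have [bad [mbad bad_le cell]] :=
    limit_step_cell h0 e0 del0 (ltn0Sn A) B0 crowd_small high_small.
  exists bad; split=> // w /cell Sw; eexists h, A, (del / 4), _.
  by split; [lra|exact: delA|exact: Sw].
have : {ae Q, forall w, \forall k \near \oo, ~ bad k w}.
  by apply: ae_near_notin_half_pow => k; case: (badP k).
apply: filterS => w good; apply: cadlag_of_partitions => e T e0.
have small : \forall k \near \oo, half_pow R k <= Num.min e (`|T| + 1)^-1.
  apply: (cvgr_le _ (@half_pow_cvg0 R)).
  by rewrite lt_min e0 invr_gt0 ltr_wpDl.
have [k [nb]] := filter_ex (filterI good small).
rewrite le_min => /andP[ke kT].
have [_ _ /(_ _ nb)[h [A [e' [c [e'k kA]]]]]] := badP k.
move=> /step_cell_partition[s [s0 sA osc]]; exists A.+1, s; split=> //.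
  apply: lt_le_trans sA; apply: le_lt_trans kA.
  have T1 : 0 < `|T| + 1 by rewrite ltr_wpDl.
  apply: (@le_trans _ _ (`|T| + 1)); first by have := ler_norm T; lra.
  by rewrite -[leLHS]invrK lef_pV2 ?posrE ?invr_gt0 ?half_pow_gt0.
move=> a u v aA ua va; apply: (le_trans (osc a u v aA ua va)).
exact: le_trans ke.
Qed.

Lemma cell_approximation_of_points del : 0 < del -> $| cell_approximation P Z Q S del|.
Proof.
move=> del0; have e0 : 0 < del / 4 by rewrite divr_gt0.
have [h [A [B [h0 hd delA B0 [crowd_small high_small]]]]] :=
  discretization_parameters alpha_gt0 e0 del0.
set e := del / 4 in e0 crowd_small high_small.
have [bad [mbad near_bad near_cell]] :=
  near_step_cell poisson tracking h0 e0 del0 (ltn0Sn A) B0 crowd_small high_small.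
have [limit_bad [mlimit_bad limit_bad_le limit_cell]] :=
  limit_step_cell h0 e0 del0 (ltn0Sn A) B0 crowd_small high_small.
have [N [mN QN NP]] := limit_cadlag.
pose height (c : {ffun 'I_A.+1 -> 'I_B.+1}) (a : nat) : nat :=
  if insub a is Some i then c i else 0%N.
have label_height d0 (O : measurableType d0) (t0 : nat -> O -> R) j0 w z :
    step_cell h A.+1 e (column_label h e B (t0^~ w) (j0^~ w)) z ->
    step_cell h A.+1 e (height (configuration_label t0 j0 h e A.+1 B w)) z.
  apply: eq_step_cell => a aA; rewrite /height.
  by case: insubP => [i _ ia|]; [rewrite configuration_labelE ia|rewrite aA].
have [mt mj _ _ _] := poisson; have [mt' mj' _ _ _] := limit_poisson.
apply/squash/(@CellApproximation _ _ _ _ _ _ _ _ _ del {ffun 'I_A.+1 -> 'I_B.+1}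
  (fun c => step_cell h A.+1 e (height c) `&` @cadlag R)
  (fun n => configuration_label (t n) (j n) h e A.+1 B)
  (configuration_label t' j' h e A.+1 B) bad (limit_bad `|` N)) => //.
- by move=> c x [].
- by move=> c x y [cx _] [cy _]; apply: step_cell_close cx cy => //; rewrite /e; lra.
- by move=> n c; exact: measurable_configuration_label.
- by move=> c; apply: measurable_configuration_label; [exact: mt' 0%N|exact: mj' 0%N|].
- by move=> c; exact: configuration_label_cvg.
- exact: measurableU.
- by rewrite measureU0.
- apply: filterS2 near_cell cadlag_Z => n cell_n cadlag_n w /cell_n Zn.
  by split=> //; exact: label_height.
- move=> w /not_orP[not_bad notN]; split; first exact/label_height/limit_cell.
  by apply: contrapT => ncad; apply: notN; exact: NP.
Qed.

Theorem D_weak_cvg_of_points : D_weak_cvg P Z Q S.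
Proof. exact: D_weak_cvg_of_cells cell_approximation_of_points. Qed.

End weak_convergence_of_points.

End poisson_like_configurations.

(** * Regularly varying tails *)

Lemma doubling_cvg_pinfty (R : realType) (phi : R -> R) (x0 m q : R) :
  0 < x0 -> 0 < m -> 1 < q -> (forall x, x0 <= x <= 2 * x0 -> m <= phi x) ->
  (forall x, x0 <= x -> q * phi x <= phi (2 * x)) -> phi x @[x --> +oo] --> +oo.
Proof.
move=> x00 m0 q1 phi_m doubling; have q0 : 0 < q by exact: lt_trans q1.
have doubling_iter k u : x0 <= u -> q ^+ k * phi u <= phi (2 ^+ k * u).
  move=> u0; elim: k => [|k IH]; first by rewrite !expr0 !mul1r.
  rewrite !exprS -!mulrA; apply: (le_trans (ler_wpM2l (ltW q0) IH)).
  apply: doubling; apply: (le_trans u0).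
  by rewrite ler_peMl ?exprn_ege1 ?ler1n// (le_trans (ltW x00)).
apply/cvgryPge => C.
have [k kC] : exists k, C <= q ^+ k * m.
  have C1 : 0 < Num.max 1 C by rewrite lt_max ltr01.
  have : geometric 1 q^-1 k @[k --> \oo] --> 0.
    by apply: cvg_geometric; rewrite ger0_norm ?invr_ge0 ?invf_lt1 ?ltW.
  move=> /cvgr_le /(_ _ (divr_gt0 m0 C1))/filter_ex[k].
  rewrite /geometric /= mul1r exprVn ler_pdivlMr// ler_pdivrMl ?exprn_gt0//.
  by rewrite ge_max => /andP[_ ?]; exists k.
near=> x.
have xk : 2 ^+ k <= x / x0 by rewrite ler_pdivlMr.
have xx0 : 0 <= x / x0 by apply: le_trans xk; exact: exprn_ge0.
pose n := Num.truncn (x / x0); pose i := trunc_log 2 n.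
have kn : (2 ^ k <= n)%N by rewrite /n truncn_ge_nat// natrX.
have xi : 2 ^+ i * x0 <= x.
  rewrite -ler_pdivlMr// -natrX -truncn_ge_nat//.
  by apply: trunc_logP => //; apply: leq_trans kn; rewrite expn_gt0.
have ix : x <= 2 ^+ i.+1 * x0.
  rewrite -ler_pdivrMr// -natrX (le_trans (ltW (truncnS_gt _)))// ler_nat.
  exact: trunc_log_ltn.
have pow_gt0 : 0 < 2 ^+ i :> R by exact: exprn_gt0.
rewrite (_ : x = 2 ^+ i * (x / 2 ^+ i)); last by rewrite mulrC divfK// lt0r_neq0.
have ux0 : x0 <= x / 2 ^+ i by rewrite ler_pdivlMr// mulrC.
apply: le_trans (doubling_iter i _ ux0); apply: (le_trans kC); apply: ler_pM.
- by rewrite exprn_ge0// ltW.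
- exact: ltW.
- by apply: ler_weXn2l; [exact: ltW|exact: trunc_log_max].
- by apply: phi_m; rewrite ux0 ler_pdivrMr// mulrAC -exprS.
Unshelve. all: by end_near. Qed.

Section tail_asymptotics.
Variable R : realType.
Variables (G l : R -> R) (alpha : R) (b : nat -> R).
Hypothesis G_nincr : {homo G : x y /~ x <= y}.
Hypothesis G_ge0 : forall x, 0 <= G x.
Hypothesis alpha01 : 0 < alpha <= 1.
Hypothesis l_slow : slowly_varying l.
Hypothesis G_equiv : (G x / (x `^ (- alpha) * l x)) @[x --> +oo] --> (1 : R).
Hypothesis l_pinfty : alpha = 1 -> l x @[x --> +oo] --> +oo.
Hypothesis b_gt0 : forall n, (0 < n)%N -> 0 < b n.
Hypothesis nGb_cvg1 : (n%:R * G (b n)) @[n --> \oo] --> (1 : R).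

Lemma tail_gt0 x : 0 < G x.
Proof.
rewrite lt_neqAle G_ge0 andbT eq_sym; apply/eqP => Gx0.
have equiv_gt0 : \forall y \near +oo, 0 < G y / (y `^ (- alpha) * l y).
  exact: (cvgr_gt _ G_equiv).
have ge_x : \forall y \near +oo, x <= y by apply: nbhs_pinfty_ge; exact: num_real.
have [y [+ xy]] := filter_ex (filterI equiv_gt0 ge_x).
have -> : G y = 0 by apply/eqP; rewrite eq_le G_ge0 andbT -Gx0 G_nincr.
by rewrite mul0r ltxx.
Qed.

Lemma normalizers_cvg_pinfty : b n @[n --> \oo] --> +oo.
Proof.
apply/cvgryPge => C; near=> n.
rewrite leNgt; apply/negP => bC.
have : n%:R * G (b n) < 2 by near: n; apply: (cvgr_lt _ nGb_cvg1); rewrite ltr1n.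
apply/negP; rewrite -leNgt (@le_trans _ _ (n%:R * G C))//.
  by rewrite -ler_pdivrMr ?tail_gt0//; near: n; exact: nbhs_infty_ger.
by rewrite ler_wpM2l// G_nincr// ltW.
Unshelve. all: by end_near. Qed.

Lemma tail_ratio y : 0 < y -> (G (y * x) / G x) @[x --> +oo] --> y `^ (- alpha).
Proof.
move=> y0; have [[a [l_gt0 _]] l_ratio] := l_slow.
pose g x := G x / (x `^ (- alpha) * l x).
have yx : y * x @[x --> +oo] --> +oo.
  by apply/cvgryPge => C; near=> x; rewrite mulrC -ler_pdivrMr.
have gy : g (y * x) @[x --> +oo] --> (1 : R) by exact: (cvg_comp _ g yx G_equiv).
have ratio_cvg : y `^ (- alpha) * (l (y * x) / l x) * g (y * x) * (g x)^-1
    @[x --> +oo] --> y `^ (- alpha) * 1 * 1 * 1^-1.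
  apply: cvgM; last by apply: cvgV => //; exact: oner_neq0.
  by apply: cvgM => //; apply: cvgM; [exact: cvg_cst|exact: l_ratio].
rewrite !mulr1 invr1 mulr1 in ratio_cvg.
apply: cvg_trans ratio_cvg; apply: near_eq_cvg; near=> x.
have x0 : 0 < x by near: x; apply: nbhs_pinfty_gt; exact: num_real.
have lx0 : 0 < l x.
  by apply: l_gt0; near: x; apply: nbhs_pinfty_gt; exact: num_real.
have lyx0 : 0 < l (y * x).
  apply: l_gt0; rewrite mulrC -ltr_pdivrMr//.
  by near: x; apply: nbhs_pinfty_gt; exact: num_real.
have Gx0 := tail_gt0 x.
have ya0 : 0 < y `^ (- alpha) by exact: powR_gt0.
have xa0 : 0 < x `^ (- alpha) by exact: powR_gt0.
by rewrite /g powRM ?ltW//; field; rewrite !lt0r_neq0.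
Unshelve. all: by end_near. Qed.

Lemma tail_scaled y : 0 < y -> (n%:R * G (y * b n)) @[n --> \oo] --> y `^ (- alpha).
Proof.
move=> y0; have ratio_b := cvg_comp b (fun x => G (y * x) / G x)
  normalizers_cvg_pinfty (tail_ratio y0).
have scaled_cvg : n%:R * G (b n) * (G (y * b n) / G (b n)) @[n --> \oo] -->
    1 * y `^ (- alpha) by exact: cvgM.
rewrite mul1r in scaled_cvg; apply: cvg_trans scaled_cvg.
apply: near_eq_cvg; apply: nearW => n.
by field; rewrite lt0r_neq0// tail_gt0.
Qed.

Lemma mul_tail_cvg_pinfty1 : alpha = 1 -> x * G x @[x --> +oo] --> +oo.
Proof.
move=> alpha1; have [[a [l_gt0 _]] _] := l_slow.
apply/cvgryPge => C; near=> x.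
have x0 : 0 < x by near: x; apply: nbhs_pinfty_gt; exact: num_real.
have lx0 : 0 < l x.
  by apply: l_gt0; near: x; apply: nbhs_pinfty_gt; exact: num_real.
have lC : 2 * C <= l x.
  by near: x; have /cvgryPge := l_pinfty alpha1; apply; exact: num_real.
have : 1 / 2 <= G x / (x `^ (- alpha) * l x).
  by near: x; apply: (cvgr_ge _ G_equiv); lra.
rewrite alpha1 powR_inv1 ?(ltW x0)// ler_pdivlMr ?mulr_gt0 ?invr_gt0//.
by rewrite mulrCA ler_pdivrMl//; lra.
Unshelve. all: by end_near. Qed.

Lemma mul_tail_cvg_pinfty_lt1 : alpha < 1 -> x * G x @[x --> +oo] --> +oo.
Proof.
move=> alpha1; pose r : R := 2 `^ (- alpha).
have r_half : 1 / 2 < r.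
  rewrite /r powRN div1r ltf_pV2 ?posrE ?powR_gt0//.
  by rewrite -ltr_ln ?posrE ?powR_gt0// ln_powR gtr_pMl// ln_gt0// ltr1n.
pose q := (1 + 2 * r) / 2.
have : \forall x \near +oo, 0 < x /\ q / 2 <= G (2 * x) / G x.
  apply: filterI; first by apply: nbhs_pinfty_gt; exact: num_real.
  by apply: (cvgr_ge _ (tail_ratio (@ltr0n R 2))); rewrite -/r /q; lra.
move=> [x0 [_ ratio_ge]]; pose x1 := Num.max 1 (x0 + 1).
have x1_gt0 : 0 < x1 by rewrite lt_max ltr01.
apply: (@doubling_cvg_pinfty _ _ x1 (x1 * G (2 * x1)) q) => //.
- by rewrite mulr_gt0// tail_gt0.
- by rewrite /q; lra.
- by move=> x /andP[xx1 x2]; apply: ler_pM; rewrite ?G_nincr// ltW.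
- move=> x; rewrite ge_max => /andP[_ x0x].
  have [|x_gt0] := ratio_ge x; first by apply: lt_le_trans x0x; rewrite ltrDl.
  rewrite ler_pdivlMr ?tail_gt0// => /(ler_wpM2l (ltW x_gt0)); lra.
Qed.

Lemma normalizers_superlinear : n%:R / b n @[n --> \oo] --> (0 : R).
Proof.
have mul_tail : x * G x @[x --> +oo] --> +oo.
  have /andP[_] := alpha01; rewrite le_eqVlt => /predU1P[|].
    exact: mul_tail_cvg_pinfty1.
  exact: mul_tail_cvg_pinfty_lt1.
have bGb := cvg_comp b (fun x => x * G x) normalizers_cvg_pinfty mul_tail.
apply/cvgr0Pnorm_le => e e0; near=> n.
have n0 : (0 < n)%N by near: n; exact: nbhs_infty_gt.
have Gb0 := tail_gt0 (b n); have bn0 := b_gt0 n0.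
rewrite ger0_norm ?divr_ge0 ?(ltW bn0)// ler_pdivrMr//.
have nGb : n%:R * G (b n) <= 2.
  by near: n; apply: (cvgr_le _ nGb_cvg1); rewrite ltr1n.
have : 2 / e <= b n * G (b n) by near: n; move/cvgryPge : bGb; apply.
rewrite ler_pdivrMr// => bG.
by rewrite -(ler_pM2r Gb0) (le_trans nGb)// (le_trans bG)// mulrC mulrA.
Unshelve. all: by end_near. Qed.

End tail_asymptotics.

(** * The Poisson random measure *)

Section mean_measure.
Variable R : realType.
Local Open Scope ereal_scope.

Lemma mean_measure_setX (mu : measure (\bar R) R) (T : set R) (Y : set (\bar R)) :
  measurable T -> mean_measure mu (T `*` Y) =
  mu Y * (@lebesgue_measure R) (T `&` `[0%R, +oo[).
Proof.
move=> mT; have -> : mean_measure mu (T `*` Y) =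
    \int[@lebesgue_measure R]_(x in `[0%R, +oo[) (mu Y * (\1_T x)%:E).
  rewrite /mean_measure (_ : [set x | (0 <= x)%R] = `[0%R, +oo[%classic).
    apply: eq_integral => x _; rewrite indicE; have [xT|xT] := boolP (x \in T).
      by rewrite in_xsectionX// mule1.
    by rewrite notin_xsectionX// measure0 mule0.
  by apply/seteqP; split => x /=; rewrite in_itv/= andbT.
rewrite ge0_integralZl//; last by apply/measurable_EFinP; exact: measurable_indic.
by rewrite integral_indic.
Qed.

End mean_measure.

Section counts.
Variable R : realType.
Local Open Scope ereal_scope.
Context d (Omega : measurableType d).
Variables (t : nat -> Omega -> R) (j : nat -> Omega -> \bar R).
Implicit Type B : set (R * \bar R).

Let indicator_ge0 (b : bool) : 0 <= (if b then 1 else 0)%R%:E :> \bar R.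
Proof. by rewrite lee_fin; case: b. Qed.

Lemma count_pts_eq0 w B : count_pts t j w B = 0 <-> forall k, ~ B (t k w, j k w).
Proof.
split=> [count0 k Bk|noB]; last by apply: eseries0 => k _ _; rewrite asboolF.
have : \sum_(0 <= i < k.+1) (if `[< B (t i w, j i w) >] then 1 else 0)%R%:E <= 0 :> \bar R.
  by rewrite -[leRHS]count0; apply: nneseries_lim_ge => i _ _.
rewrite big_nat_recr//= asboolT//; apply/negP; rewrite -ltNge.
by rewrite (@lt_le_trans _ _ 1) ?lte01// leeDr//; exact: sume_ge0.
Qed.

Lemma count_pts_gt1 w B k k' : (k < k')%N -> B (t k w, j k w) ->
  B (t k' w, j k' w) -> 1 < count_pts t j w B.
Proof.
move=> kk' Bk Bk'.
have : \sum_(0 <= i < k'.+1) (if `[< B (t i w, j i w) >] then 1 else 0)%R%:E <=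
    count_pts t j w B by apply: nneseries_lim_ge => i _ _.
apply: lt_le_trans; rewrite big_nat_recr//= asboolT//.
rewrite big_mkord (bigD1 (Ordinal kk'))//= asboolT// -addeA.
apply: (@lt_le_trans _ _ (1 + 1)); first by rewrite lte_fin ltrDl.
by rewrite leeD// leeDr//; exact: sume_ge0.
Qed.

Hypothesis measurable_t : forall k, measurable_fun setT (t k).
Hypothesis measurable_j : forall k, measurable_fun setT (j k).

Lemma measurable_point_mem B k : measurable B -> measurable [set w | B (t k w, j k w)].
Proof.
move=> mB; have := measurable_fun_pair (measurable_t k) (measurable_j k).
by move=> /(_ measurableT _ mB); rewrite setTI.
Qed.

Lemma measurable_count_pts B : measurable B ->
  measurable_fun setT (fun w => count_pts t j w B).
Proof.
move=> mB; apply: ge0_emeasurable_sum => [k w _ _|k _]; first exact: indicator_ge0.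
apply/measurable_EFinP; rewrite (_ : (fun _ => _) = \1_[set w | B (t k w, j k w)]).
  exact/measurable_indic/measurable_point_mem.
apply/funext => w; rewrite indicE.
by case: asboolP => Bk; [rewrite mem_set|rewrite memNset].
Qed.

Lemma measurable_count_pts_eq B c : measurable B ->
  measurable [set w | count_pts t j w B = c%:R%:E].
Proof.
move=> /measurable_count_pts/(_ measurableT _ (emeasurable_set1 c%:R%:E)).
by rewrite setTI; exact.
Qed.

End counts.

Section poisson_random_measure.
Variable R : realType.
Local Open Scope ereal_scope.
Context d (Omega : measurableType d) (Q : probability Omega R).
Variables (t : nat -> Omega -> R) (j : nat -> Omega -> \bar R).
Variables (mu : measure (\bar R) R) (alpha : R).
Hypothesis mu_alpha : is_mu_ab 1 alpha mu.
Hypothesis prm : is_PRM Q t j (mean_measure mu).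

Let measurable_t : forall k, measurable_fun setT (t k). Proof. by case: prm. Qed.
Let measurable_j : forall k, measurable_fun setT (j k). Proof. by case: prm => _ []. Qed.

Lemma prm_count (B : set (R * \bar R)) (c : nat) : measurable B ->
  mean_measure mu B < +oo ->
  Q [set w | count_pts t j w B = c%:R%:E] =
  (Defs.poisson_pmf (fine (mean_measure mu B)) c)%:E.
Proof.
move=> mB fB; have [_ [_ /(_ 1%N (fun=> B) (fun=> c))]] := prm.
rewrite big_ord1 => <- //; last by move=> i i'; rewrite (ord1 i) (ord1 i') eqxx.
by congr (Q _); apply/seteqP; split => w /= countB // ; exact: (countB ord0).
Qed.

Lemma prm_null (B : set (R * \bar R)) : measurable B -> mean_measure mu B = 0 ->
  Q (\bigcup_k [set w | B (t k w, j k w)]) = 0.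
Proof.
move=> mB B0.
have -> : \bigcup_k [set w | B (t k w, j k w)] = ~` [set w | count_pts t j w B = 0].
  apply/seteqP; split => w /=; first by move=> [k _ Bk] /count_pts_eq0/(_ k).
  move=> countB; apply: contrapT => noB; apply: countB; apply/count_pts_eq0 => k Bk.
  by apply: noB; exists k.
rewrite probability_setC; last exact: (measurable_count_pts_eq _ _ 0%N).
rewrite (prm_count 0%N)// B0 ?ltry//.
by rewrite /Defs.poisson_pmf /= oppr0 expR0 mul1r expr0 divr1 subee.
Qed.

Let measurable_above (y : \bar R) : measurable [set z | y < z].
Proof.
rewrite (_ : [set _ | _] = `]y, +oo]%classic); first exact: emeasurable_itv.
by apply/seteqP; split => z /=; rewrite in_itv /= leey andbT.
Qed.

Let mu_above (y : R) : (0 < y)%R -> mu [set z | y%:E < z] = (y `^ (- alpha))%:E.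
Proof. by move=> y0; have [_ ->//] := mu_alpha; rewrite mul1r. Qed.

Definition column_box (h : R) (a : nat) (y : R) : set (R * \bar R) :=
  [set` `[a%:R * h, a.+1%:R * h[%R] `*` [set z | y%:E < z].

Lemma column_boxE h a y w k :
  column_box h a y (t k w, j k w) <-> large_point t j h y a k w.
Proof. by rewrite /column_box /large_point /in_column /= in_itv. Qed.

Lemma measurable_column_box h a y : measurable (column_box h a y).
Proof. exact: measurableX. Qed.

Lemma mean_measure_column_box h a y : (0 < h)%R -> (0 < y)%R ->
  mean_measure mu (column_box h a y) = (h * y `^ (- alpha))%:E.
Proof.
move=> h0 y0; rewrite mean_measure_setX// mu_above//.
have ah0 : (0 <= a%:R * h)%R by rewrite mulr_ge0// ltW.
rewrite (_ : _ `&` _ = [set` `[a%:R * h, a.+1%:R * h[%R]); last first.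
  apply/setIidPl => x /=; rewrite !in_itv/= => /andP[ax _].
  by rewrite andbT (le_trans ah0).
rewrite lebesgue_measure_itv/= lte_fin ltr_pM2r// ltr_nat ltnSn -EFinB -mulrBl.
by rewrite -[a.+1%:R]natr1 addrAC subrr add0r mul1r muleC.
Qed.

Lemma prm_early e : (0 < e)%R -> Q (early_point t j e) = 0.
Proof.
move=> e0; apply: (@prm_null ([set` `]-oo, 0]%R] `*` [set z | e%:E < z])).
  exact: measurableX.
rewrite mean_measure_setX// (_ : _ `&` _ = [set 0%R]).
  by rewrite lebesgue_measure_set1 mule0.
apply/seteqP; split => x /=; rewrite !in_itv/= ?andbT.
  by move=> [x0 x0']; apply/eqP; rewrite eq_le x0.
by move=> ->.
Qed.

Lemma prm_nonpos : Q (\bigcup_k [set w | j k w <= 0]) = 0.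
Proof.
have -> : \bigcup_k [set w | j k w <= 0] =
    \bigcup_k [set w | (setT `*` [set y | y <= 0]) (t k w, j k w)].
  by apply: eq_bigcupr => k _; apply/seteqP; split => w //= [].
apply: prm_null.
  apply: measurableX => //.
  rewrite (_ : [set _ | _] = `]-oo, 0]%classic); first exact: emeasurable_itv.
  by apply/seteqP; split => y /=; rewrite in_itv.
by rewrite mean_measure_setX//; have [-> _] := mu_alpha; rewrite mul0e.
Qed.

Lemma prm_crowded_column (h e : R) (a : nat) : (0 < h)%R -> (0 < e)%R ->
  Q (crowded_column t j h e a) <= ((h * e `^ (- alpha)) ^+ 2)%:E.
Proof.
move=> h0 e0; set lam := (h * e `^ (- alpha))%R.
have lam0 : (0 <= lam)%R by rewrite mulr_ge0 ?powR_ge0// ltW.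
have mbox := measurable_column_box h a e.
have meanE : mean_measure mu (column_box h a e) = lam%:E.
  exact: mean_measure_column_box.
pose count c := [set w | count_pts t j w (column_box h a e) = c%:R%:E].
have mcount c : measurable (count c) by exact: measurable_count_pts_eq.
have Q_count c : Q (count c) = (Defs.poisson_pmf lam c)%:E.
  by rewrite prm_count// meanE// ltry.
have Q_count01 : Q (count 0%N `|` count 1%N) = (expR (- lam) * (1 + lam))%:E.
  transitivity (Q (count 0%N) + Q (count 1%N)).
    apply: measureU => //; apply/seteqP; split => w //; rewrite /count /=.
    by move=> [-> /eqP]; rewrite eqe eqr_nat.
  rewrite !Q_count -EFinD /Defs.poisson_pmf expr0 expr1 !divr1 mulr1.
  by rewrite mulrDr mulr1.
apply: (@le_trans _ _ (Q (~` (count 0%N `|` count 1%N)))).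
  apply: le_measure; rewrite ?inE; first exact: measurable_crowded_column.
    exact/measurableC/measurableU.
  move=> w [k _ [k' kk' [bk bk']]].
  have count_gt1 := count_pts_gt1 kk' ((column_boxE _ _ _ _ _).2 bk)
    ((column_boxE _ _ _ _ _).2 bk').
  by case=> /= countE; move: count_gt1; rewrite countE lte_fin ?ltxx// ltr10.
rewrite probability_setC; last exact: measurableU.
by rewrite Q_count01 -EFinB lee_fin; have := expR_ge1Dx (- lam); nra.
Qed.

Lemma prm_void_columns (h : R) (A : nat) (D : pred 'I_A) (y : 'I_A -> R) :
  (0 < h)%R -> (forall a, 0 < y a)%R ->
  fine (Q (void_columns t j h D y)) = expR (- \sum_(a | D a) h * y a `^ (- alpha))%R.
Proof.
move=> h0 y0; pose B (a : 'I_A) := if D a then column_box h a (y a) else set0.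
have mB a : measurable (B a) by rewrite /B; case: ifP => _ //; exact: measurable_column_box.
have meanB a : mean_measure mu (B a) = (if D a then h * y a `^ (- alpha) else 0)%R%:E.
  rewrite /B; case: ifP => _; first exact: mean_measure_column_box.
  by rewrite -(@setX0 _ _ setT) mean_measure_setX// measure0 mul0e.
have disjB a a' : a != a' -> B a `&` B a' = set0.
  move=> aa'; rewrite /B; case: ifP => _; last by rewrite set0I.
  case: ifP => _; last by rewrite setI0.
  apply/seteqP; split => -[x z] //= [[/= xa _] [/= xa' _]].
  by move: aa'; rewrite (val_inj (in_column_inj h0 xa xa')) eqxx.
have [_ [_ /(_ A B (fun=> 0%N) mB)]] := prm.
rewrite (_ : [set w | _] = void_columns t j h D y); last first.
  apply/seteqP; split => w /= void a.
    move=> Da k ka; rewrite leNgt; apply/negP => kj.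
    have /count_pts_eq0/(_ k) := void a; apply; rewrite /B Da.
    by apply/column_boxE.
  apply/count_pts_eq0 => k; rewrite /B; case: ifPn => [Da /column_boxE[ka kj]|_ []].
  by have := void a Da k ka; rewrite leNgt kj.
move=> ->//; last by move=> a; rewrite meanB ltry.
rewrite /= [in RHS]big_mkcond -sumrN expR_sum; apply: eq_bigr => a _.
by rewrite /Defs.poisson_pmf meanB /= expr0 mulr1 divr1; case: ifP.
Qed.

Lemma prm_asymptotically_poisson :
  asymptotically_poisson alpha Q (fun=> t) (fun=> j).
Proof.
split=> // [h A D y h0 y0|h e a h0 e0|e p e0 p0].
- by rewrite prm_void_columns//; exact: cvg_cst.
- by apply: nearW => _; exact: prm_crowded_column.
- by apply: nearW => _; rewrite prm_early// lee_fin ltW.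
Qed.

Lemma sup0_tracks (s : nat -> R) (x : nat -> \bar R) (T e H : R) : (0 < e)%R ->
  (forall k, 0 < x k) -> (forall k, (s k < T)%R -> x k <= H%:E) ->
  tracks T e s x (fun u => fine (Defs.sup0 [set x k | k in [set k | (s k <= u)%R]])).
Proof.
move=> e0 x_gt0 x_le u /andP[u0 uT]; rewrite /Defs.sup0; set A := [set x k | k in _].
case: asboolP => [A0|/eqP/set0P[_ [k0 /= k0u _]]].
  split => /=; [by rewrite oppr_le0 ltW| |by left; rewrite ltW].
  by move=> k ku; exfalso; have : A (x k) by [exists k]; rewrite A0.
have sup_le : ereal_sup A <= H%:E.
  by apply: ge_ereal_sup => _ [k /= ku <-]; apply: x_le; exact: le_lt_trans uT.
have sup_ge0 : 0 <= ereal_sup A.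
  by apply: (le_trans (ltW (x_gt0 k0))); apply: ereal_sup_ubound; exists k0.
have sup_fin : ereal_sup A \is a fin_num.
  by rewrite ge0_fin_numE// (le_lt_trans sup_le)// ltry.
have supE : (fine (ereal_sup A))%:E = ereal_sup A by rewrite fineK.
split.
- by rewrite (@le_trans _ _ 0%R) ?oppr_le0 ?fine_ge0// ltW.
- move=> k ku; rewrite EFinD supE; apply: (@le_trans _ _ (ereal_sup A)).
    by apply: ereal_sup_ubound; exists k.
  by rewrite leeDl// lee_fin ltW.
- right; have [_ [k /= ku <-] near_sup] := ub_ereal_sup_adherent e0 sup_fin.
  by exists k => //; rewrite EFinB supE ltW.
Qed.

Lemma prm_tracks : asymptotically_tracks Q (fun=> t) (fun=> j) (fun=> sup_process t j).
Proof.
move=> T e H p T0 e0 H0 p0; exists (fun=> \bigcup_k [set w | j k w <= 0]); split.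
- move=> _; apply: bigcup_measurable => k _.
  rewrite -[X in measurable X]setTI.
  exact: (emeasurable_fun_infty_c measurableT (measurable_j k)).
- by apply: nearW => _; rewrite prm_nonpos lee_fin ltW.
- apply: nearW => _ w nonneg jH; apply: (sup0_tracks e0 _ jH) => k.
  by rewrite ltNge; apply/negP => jk; apply: nonneg; exists k.
Qed.

End poisson_random_measure.

(** * Random integers and independence *)

Section nat_random_variables.
Context d (T : measurableType d).

Lemma nat_rv_cst n : nat_rv (fun _ : T => n).
Proof.
move=> A; have [An|An] := pselect (A n).
  by rewrite (_ : _ @^-1` _ = setT)//; apply/seteqP; split.
by rewrite (_ : _ @^-1` _ = set0)//; apply/seteqP; split.
Qed.

Lemma nat_rv_bind (N : T -> nat) (F : nat -> T -> nat) :
  nat_rv N -> (forall n, nat_rv (F n)) -> nat_rv (fun w => F (N w) w).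
Proof.
move=> rvN rvF A.
rewrite (_ : _ @^-1` A = \bigcup_n (N @^-1` [set n] `&` F n @^-1` A)).
  by apply: bigcup_measurable => n _; apply: measurableI; [exact: rvN|exact: rvF].
apply/seteqP; split => w /=; first by move=> Aw; exists (N w).
by move=> [n _ [/= -> ]].
Qed.

Lemma nat_rv_add (X Y : T -> nat) : nat_rv X -> nat_rv Y ->
  nat_rv (fun w => X w + Y w)%N.
Proof.
move=> rvX rvY; apply: (nat_rv_bind (F := fun n w => n + Y w)%N) => // n A.
exact: (rvY [set m | A (n + m)%N]).
Qed.

Lemma nat_rv_sum n (X : nat -> T -> nat) : (forall l, nat_rv (X l)) ->
  nat_rv (fun w => \sum_(l < n) X l w)%N.
Proof.
move=> rvX; elim: n => [|n IH].
  by under eq_fun do rewrite big_ord0; exact: nat_rv_cst.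
by under eq_fun do rewrite big_ord_recr /=; exact: nat_rv_add.
Qed.

Lemma nat_rv_GW (xi : nat -> nat -> T -> nat) m :
  (forall m' l, (m' < m)%N -> nat_rv (xi m' l)) ->
  nat_rv (fun w => GW (fun m l => xi m l w) m).
Proof.
elim: m => [_|m IH rv_xi]; first exact: nat_rv_cst.
rewrite /=; apply: (nat_rv_bind (F := fun n w => \sum_(l < n) xi m l w)%N).
  by apply: IH => m' l m'm; apply: rv_xi; exact: ltnW.
by move=> n; apply: nat_rv_sum => l; exact: rv_xi.
Qed.

Lemma nat_rv_measurable_fun (R : realType) (X : T -> nat) : nat_rv X ->
  measurable_fun setT (fun w => (X w)%:R : R).
Proof.
by move=> rvX _ A mA; rewrite setTI; exact: (rvX [set n | A n%:R]).
Qed.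

End nat_random_variables.

Lemma bigcap_cons (T : Type) (I : eqType) (i : I) (s : seq I) (E : I -> set T) :
  \bigcap_(k in [set` i :: s]) E k = E i `&` \bigcap_(k in [set` s]) E k.
Proof.
apply/seteqP; split=> w /= => [Ew|[Ei Es] k].
  by split=> [|k sk]; apply: Ew; rewrite /= inE ?eqxx// (sk : k \in s) orbT.
by rewrite /= inE => /predU1P[->|/Es].
Qed.

Section independence.
Local Open Scope ereal_scope.
Variable R : realType.
Context d (T : measurableType d) (P : probability T R).

Lemma mutually_independent_comp (I I' : eqType) (F : I -> T -> nat) (g : I' -> I) :
  injective g -> mutually_independent P F -> mutually_independent P (F \o g).
Proof.
move=> g_inj indep s A us; pose B i := [set n | forall i', g i' = i -> A i' n].
have BE i' : B (g i') = A i'.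
  by apply/seteqP; split=> n /= => [|An i'' /g_inj ->//]; exact.
have := indep (map g s) B; rewrite map_inj_uniq// big_map => /(_ us).
under [in X in _ = X]eq_bigr do rewrite BE.
move=> <-; congr (P _); apply/seteqP; split => w /= FA i.
  by move=> /mapP[i' si' ->]; rewrite BE; exact: FA.
by move=> si; rewrite -BE; apply: FA; rewrite map_f.
Qed.

Lemma prob_bigcap_setC (I : eqType) (E : I -> set T) (p : I -> R) :
  (forall i, measurable (E i)) ->
  (forall s, uniq s -> P (\bigcap_(i in [set` s]) E i) = (\prod_(i <- s) p i)%:E) ->
  forall s, uniq s ->
    P (\bigcap_(i in [set` s]) ~` E i) = (\prod_(i <- s) (1 - p i))%:E.
Proof.
move=> mE prodE.
pose inside (s : seq I) := \bigcap_(i in [set` s]) E i.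
pose outside (s : seq I) := \bigcap_(i in [set` s]) ~` E i.
have m_inside s : measurable (inside s).
  by apply: fin_bigcap_measurable => //; exact: finite_seq.
have m_outside s : measurable (outside s).
  by apply: fin_bigcap_measurable => [|i _]; [exact: finite_seq|exact: measurableC].
suff mixed out s : uniq (out ++ s) -> P (outside out `&` inside s) =
    (\prod_(i <- out) (1 - p i) * \prod_(i <- s) p i)%:E.
  move=> s us; have := mixed s [::]; rewrite cats0 => /(_ us).
  by rewrite /inside set_nil bigcap_set0 setIT big_nil mulr1.
elim: out s => [|i out IH] s us.
  by rewrite /outside set_nil bigcap_set0 setTI big_nil mul1r -prodE.
have us' : uniq (out ++ i :: s) by rewrite -[i :: s]cat1s uniq_catCA.
have us'' : uniq (out ++ s) by case/andP: us.
have -> : outside (i :: out) `&` inside s = outside out `&` inside s `\` E i.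
  by rewrite /outside bigcap_cons -setIA setIC -setDE.
transitivity (P (outside out `&` inside s) - P (outside out `&` inside (i :: s))).
  have -> : outside out `&` inside (i :: s) = outside out `&` inside s `&` E i.
    by rewrite /inside bigcap_cons setIC -setIA setIC [_ `&` outside out]setIC.
  apply: measureD => //; first exact: measurableI.
  by rewrite ltey_eq fin_num_measure//; exact: measurableI.
by rewrite !IH// -EFinB !big_cons; congr (_%:E); ring.
Qed.

Variables (I : eqType) (F : I -> T -> nat).
Hypothesis nat_rv_F : forall i, nat_rv (F i).
Hypothesis independent_F : mutually_independent P F.

Definition cylinders (D : set I) : set (set T) := [set E | exists s A,
  [/\ uniq s, [set` s] `<=` D & E = \bigcap_(i in [set` s]) F i @^-1` A i]].

Lemma measurable_cylinder D E : cylinders D E -> measurable E.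
Proof.
move=> [s [A [_ _ ->]]]; apply: fin_bigcap_measurable => [|i _]; first exact: finite_seq.
exact: nat_rv_F.
Qed.

Lemma setI_closed_cylinders D : setI_closed (cylinders D).
Proof.
move=> _ _ [s1 [A1 [us1 sD1 ->]]] [s2 [A2 [us2 sD2 ->]]].
exists (undup (s1 ++ s2)),
  (fun i => [set n | (i \in s1 -> A1 i n) /\ (i \in s2 -> A2 i n)]); split.
- exact: undup_uniq.
- by move=> i /=; rewrite mem_undup mem_cat => /orP[/sD1|/sD2].
- apply/seteqP; split => w /=.
    by move=> [in1 in2] i _; split => ?; [exact: in1|exact: in2].
  by move=> in12; split => i si; have := in12 i; rewrite /= mem_undup mem_cat si ?orbT;
    move=> /(_ isT)[]; auto.
Qed.

Lemma independent_cylinder D i0 (A : set nat) (E : set T) : ~ D i0 -> cylinders D E ->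
  P (E `&` F i0 @^-1` A) = P E * P (F i0 @^-1` A).
Proof.
move=> Di0 [s [B [us sD ->]]]; pose B' i := if i == i0 then A else B i.
have si0 : i0 \notin s by apply/negP => /sD.
have B'E i : i \in s -> B' i = B i.
  by rewrite /B'; case: eqVneq => // -> i0s; rewrite i0s in si0.
have B'i0 : B' i0 = A by rewrite /B' eqxx.
have us' : uniq (i0 :: s) by rewrite /= si0.
have := independent_F B' us'; rewrite big_cons B'i0 muleC.
rewrite (eq_big_seq (fun i => P (F i @^-1` B i))) => [|i /B'E ->//].
rewrite -(independent_F B us) => <-; congr (P _); apply/seteqP; split => w /=.
  move=> [Bw Aw] i; rewrite inE => /predU1P[->|si]; first by rewrite B'i0.
  by rewrite B'E//; exact: Bw.
move=> B'w; split; last by have := B'w i0 (mem_head _ _); rewrite B'i0.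
by move=> i si; rewrite -B'E//; apply: B'w; rewrite inE si orbT.
Qed.

(* Both sides are finite measures in E that agree on cylinders, a pi-system. *)
Lemma independent_sigma_cylinders D i0 (A : set nat) (E : set T) : ~ D i0 ->
  <<s cylinders D >> E -> P (E `&` F i0 @^-1` A) = P E * P (F i0 @^-1` A).
Proof.
move=> Di0 sE; have mA : measurable (F i0 @^-1` A) by exact: nat_rv_F.
have PA0 : (0 <= fine (P (F i0 @^-1` A)))%R by exact: fine_ge0.
pose restricted : measure T R := mrestr P mA.
pose scaled : measure T R := mscale (NngNum PA0) P.
have scaledE B : scaled B = P B * P (F i0 @^-1` A).
  by rewrite /scaled /= /mscale /= fineK ?fin_num_measure// muleC.
rewrite -scaledE.
apply: (@g_sigma_algebra_measure_unique _ _ _ (cylinders D) _ (fun=> setT) _ _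
  restricted scaled) => //.
- by move=> B; exact: measurable_cylinder.
- move=> _; exists [::], (fun=> setT); split => //.
  by rewrite set_nil bigcap_set0.
- by apply/seteqP; split => // w _; exists 0%N.
- exact: setI_closed_cylinders.
- by move=> B cylB; rewrite scaledE; exact: independent_cylinder cylB.
- by move=> k; rewrite /restricted /= /mrestr setTI ltey_eq fin_num_measure.
Qed.

Lemma nat_rv_cylinders (D : set I) i : D i ->
  @nat_rv _ (g_sigma_algebraType (cylinders D)) (F i).
Proof.
move=> Di A; apply: sub_sigma_algebra; exists [:: i], (fun=> A); split => //.
  by move=> k /=; rewrite inE => /eqP ->.
by rewrite set_cons1 bigcap_set1.
Qed.

End independence.

Section nat_expectations.
Local Open Scope ereal_scope.
Variable R : realType.

Lemma sum_nat_series (n : nat) (f : nat -> nat) :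
  ((\sum_(l < n) f l)%N%:R : R)%:E =
  \sum_(0 <= l <oo) (if (l < n)%N then (f l)%:R else 0)%R%:E.
Proof.
rewrite (nneseries_split 0 n); last by move=> k _; rewrite lee_fin; case: ifP.
rewrite add0n [X in _ = _ + X]eseries0 ?adde0; last first.
  by move=> i ni _; rewrite ltnNge ni.
by rewrite big_mkord natr_sum -sumEFin; apply: eq_bigr => i _; rewrite ltn_ord.
Qed.

Context d (T : measurableType d) (P : probability T R).

Lemma nat_rv_integral (X : T -> nat) (C : set T) : nat_rv X -> measurable C ->
  \int[P]_w ((X w)%:R * \1_C w)%:E =
  \sum_(0 <= v <oo) P (C `&` X @^-1` [set n | (v < n)%N]).
Proof.
move=> rvX mC.
have m_above v : measurable (C `&` X @^-1` [set n | (v < n)%N]).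
  by apply: measurableI => //; exact: rvX.
transitivity (\int[P]_w \sum_(0 <= v <oo)
    (\1_(C `&` X @^-1` [set n | (v < n)%N]) w)%:E).
  apply: eq_integral => w _.
  rewrite indicE; have [wC|wC] := boolP (w \in C); last first.
    rewrite mulr0 eseries0// => v _ _; rewrite indicE memNset//.
    by case=> Cw; rewrite mem_set in wC.
  have := sum_nat_series (X w) (fun=> 1%N); rewrite sum1_card card_ord mulr1 => ->.
  apply: eq_eseriesr => v _; rewrite indicE.
  case: ifPn => vX; first by rewrite mem_set//; split => //; exact: set_mem.
  by rewrite memNset//; move=> [_ /=]; apply/negP.
rewrite integral_nneseries//; last first.
  by move=> v; apply/measurable_EFinP; exact: measurable_indic.
by apply: eq_eseriesr => v _; rewrite integral_indic// setIT.
Qed.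

Lemma nat_rv_expectation (X : T -> nat) : nat_rv X ->
  \int[P]_w ((X w)%:R : R)%:E = \sum_(0 <= v <oo) P (X @^-1` [set n | (v < n)%N]).
Proof.
move=> rvX; have := nat_rv_integral rvX measurableT.
under eq_integral do rewrite indicT mulr1.
by move=> ->; apply: eq_eseriesr => v _; rewrite setTI.
Qed.

Lemma integral_random_sum (N : T -> nat) (Y : nat -> T -> nat) (m : R) :
  nat_rv N -> (forall l, nat_rv (Y l)) ->
  (forall l, \int[P]_w ((Y l w)%:R : R)%:E = m%:E) ->
  (forall l A, P (N @^-1` [set n | (l < n)%N] `&` Y l @^-1` A) =
     P (N @^-1` [set n | (l < n)%N]) * P (Y l @^-1` A)) ->
  \int[P]_w ((\sum_(l < N w) Y l w)%N%:R : R)%:E = m%:E * \int[P]_w ((N w)%:R : R)%:E.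
Proof.
move=> rvN rvY meanY indep; pose above l := N @^-1` [set n | (l < n)%N].
have m_above l : measurable (above l) by exact: rvN.
transitivity (\int[P]_w \sum_(0 <= l <oo) ((Y l w)%:R * \1_(above l) w : R)%:E).
  apply: eq_integral => w _; rewrite (@sum_nat_series (N w) (Y ^~ w)).
  apply: eq_eseriesr => l _; rewrite indicE; case: ifPn => lN.
    by rewrite mem_set ?mulr1.
  by rewrite memNset ?mulr0//; exact/negP.
rewrite integral_nneseries//; last first.
  move=> l; apply/measurable_EFinP/measurable_funM; last exact: measurable_indic.
  exact: nat_rv_measurable_fun.
have meanYN l : \int[P]_w ((Y l w)%:R * \1_(above l) w)%:E = m%:E * P (above l).
  rewrite nat_rv_integral// -(meanY l) nat_rv_expectation// muleC.
  have fin_above : P (above l) \is a fin_num by exact: fin_num_measure.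
  rewrite -(fineK fin_above) -nneseriesZl//.
  by apply: eq_eseriesr => v _; rewrite fineK//; exact: indep.
under eq_eseriesr do rewrite meanYN.
by rewrite nat_rv_expectation// -nneseriesZl// => l _; exact: measure_ge0.
Qed.

End nat_expectations.

Section GW_mean.
Local Open Scope ereal_scope.
Variable R : realType.
Context d (T : measurableType d) (P : probability T R).
Variables (I : eqType) (F : I -> T -> nat).
Hypothesis nat_rv_F : forall i, nat_rv (F i).
Hypothesis independent_F : mutually_independent P F.

Lemma integral_GW (ix : nat -> nat -> I) (mu : R) m :
  (forall m l m' l', ix m l = ix m' l' -> m = m') ->
  (forall m l, \int[P]_w ((F (ix m l) w)%:R : R)%:E = mu%:E) ->
  \int[P]_w ((GW (fun m l => F (ix m l) w) m)%:R : R)%:E = (mu ^+ m)%:E.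
Proof.
move=> ix_inj meanF; elim: m => [|m IH].
  by rewrite expr0 /= integral_cst//= (@probability_setT _ _ _ P) mul1e.
rewrite [LHS](integral_random_sum (Y := fun l => F (ix m l)) (m := mu)) => //.
- by rewrite IH exprS EFinM.
- by apply: nat_rv_GW.
move=> l A; apply: (@independent_sigma_cylinders _ _ _ _ _ _ nat_rv_F independent_F
  [set i | i <> ix m l]); first by move=> /(_ erefl).
have : @nat_rv _ (g_sigma_algebraType (cylinders F [set i | i <> ix m l]))
    (fun w => GW (fun m l => F (ix m l) w) m).
  apply: (@nat_rv_GW _ (g_sigma_algebraType (cylinders F [set i | i <> ix m l]))
    (fun m l => F (ix m l))).
  move=> m' l' m'm; apply: nat_rv_cylinders => /= /ix_inj mE.
  by rewrite mE ltnn in m'm.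
by move=> /(_ [set n | (l < n)%N]).
Qed.

End GW_mean.

(** * Bounds on the population *)

Section population_paths.

Lemma GW_gt0 (xi : nat -> nat -> nat) m :
  (forall m', (m' < m)%N -> (0 < xi m' 0)%N) -> (0 < GW xi m)%N.
Proof.
elim: m => // m IH xi0 /=.
have GWm : (0 < GW xi m)%N by apply: IH => m' m'm; apply: xi0; exact: ltnW.
rewrite (bigD1 (Ordinal GWm))//=; apply: (leq_trans (xi0 m _)) => //.
exact: leq_addr.
Qed.

Lemma block_sum_ge (x : nat -> nat) r n :
  (forall c, (c < n)%N -> exists2 i, (c * r < i <= c.+1 * r)%N & (0 < x i)%N) ->
  (n <= \sum_(1 <= i < (n * r).+1) x i)%N.
Proof.
elim: n => // n IH xP.
rewrite (@big_cat_nat _ _ _ (n * r).+1)//=; last by rewrite ltnS leq_mul2r leqnSn orbT.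
rewrite -[leqLHS]addn1; apply: leq_add.
  by apply: IH => c cn; apply: xP; exact: ltnW.
have [i /andP[i1 i2] xi0] := xP n (ltnSn n).
rewrite (bigD1_seq i)/= ?iota_uniq//; first exact: (leq_trans xi0 (leq_addr _ _)).
by rewrite mem_index_iota i1.
Qed.

Variables (Omega : Type) (xi : nat -> nat -> nat -> nat -> Omega -> nat).
Variables (J : nat -> Omega -> nat) (w : Omega).

Definition descendants (i k m : nat) (w : Omega) : nat := GW (fun m l => xi i k m l w) m.

Definition line_survives (K k i : nat) : set Omega :=
  \bigcap_(m in [set` iota 0 K]) xi i k m 0 @^-1` [set n | (0 < n)%N].

Definition block_dies (K r k c : nat) : set Omega :=
  \bigcap_(i in [set` iota (c * r).+1 r]) ~` line_survives K k i.

Lemma GWI_ge_blocks (K r n k : nat) : (k <= n)%N -> (n <= K)%N ->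
  (forall c, (c < J k w %/ r)%N -> ~ block_dies K r k c w) ->
  (J k w %/ r <= GWI xi J n w)%N.
Proof.
move=> kn nK alive.
apply: (@leq_trans (\sum_(1 <= i < (J k w).+1) descendants i k (n - k) w)%N); last first.
  by rewrite /GWI [leqRHS](bigD1_seq k) ?mem_index_iota ?iota_uniq//= leq_addr.
apply: (@leq_trans (\sum_(1 <= i < ((J k w %/ r) * r).+1) descendants i k (n - k) w)%N);
  last first.
  rewrite [leqRHS](@big_cat_nat _ _ _ (J k w %/ r * r).+1)//= ?leq_addr//.
  by rewrite ltnS leq_divM.
apply: block_sum_ge => c /alive/existsNP[i /not_implyP[ic /contrapT survives]].
exists i; first by move: ic; rewrite /= mem_iota addSn ltnS mulSn [(r + _)%N]addnC.
apply: GW_gt0 => m mn; apply: survives; rewrite /= mem_iota /= add0n.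
by rewrite (leq_trans mn)// (leq_trans (leq_subr _ _)).
Qed.

Variable R : realType.

(* Dividing by i the descendants of the i-th immigrant turns a bound on this sum
   into a bound on the total progeny that is linear in the number of immigrants. *)
Definition weighted_progeny (K N : nat) (w : Omega) : R :=
  \sum_(0 <= k < K) \sum_(1 <= i < N.+1) \sum_(0 <= m < K)
    (i%:R)^-1 * (descendants i k m w)%:R.

Lemma GWI_le_weighted K N n : (n < K)%N ->
  (forall k, (k <= n)%N -> (J k w <= N)%N) ->
  (GWI xi J n w)%:R <= (\max_(k < n.+1) J k w)%:R * weighted_progeny K N w :> R.
Proof.
move=> nK JN; have term_ge0 i k m : 0 <= (i%:R)^-1 * (descendants i k m w)%:R :> R.
  by rewrite mulr_ge0// invr_ge0.
rewrite /GWI /weighted_progeny natr_sum.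
rewrite [X in _ * X](@big_cat_nat _ _ _ n.+1)//= mulrDr ler_wpDr//.
  by rewrite mulr_ge0//; do 3 (apply: sumr_ge0 => ? _).
rewrite mulr_sumr [leLHS]big_nat [leRHS]big_nat; apply: ler_sum => k /andP[_ kn].
rewrite natr_sum [X in _ * X](@big_cat_nat _ _ _ (J k w).+1)//=; last by rewrite ltnS JN.
rewrite mulrDr ler_wpDr//; first by rewrite mulr_ge0//; do 2 (apply: sumr_ge0 => ? _).
rewrite mulr_sumr [leLHS]big_nat [leRHS]big_nat; apply: ler_sum => i /andP[i0 iJ].
have nkK : (n - k < K)%N by exact: leq_ltn_trans (leq_subr _ _) nK.
rewrite (bigD1_seq (n - k)%N)/= ?iota_uniq ?mem_index_iota// mulrDr ler_wpDr//.
  by rewrite mulr_ge0// sumr_ge0.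
rewrite mulrA ler_peMl// ler_pdivlMr ?ltr0n// mul1r ler_nat.
apply: (leq_trans (iJ : (i <= J k w)%N)).
exact: (@leq_bigmax _ (fun k : 'I_n.+1 => J k w) (Ordinal kn)).
Qed.

End population_paths.

Lemma harmonic_le (R : realType) (N : nat) :
  \sum_(1 <= i < N.+1) (i%:R : R)^-1 <= 1 + ln N%:R.
Proof.
case: N => [|N]; first by rewrite big_geq// ln0// addr0 ler01.
elim: N => [|N IH]; first by rewrite big_nat1 invr1 ln1 addr0.
rewrite big_nat_recr//=.
have N1 : (0 : R) < N.+1%:R by rewrite ltr0n.
have N2 : (0 : R) < N.+2%:R by rewrite ltr0n.
have : ln (1 + - (N.+2%:R)^-1 : R) <= - (N.+2%:R)^-1.
  by apply: le_ln1Dx; rewrite ltrN2 invf_lt1// ltr1n.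
have -> : (1 - (N.+2%:R)^-1 : R) = N.+1%:R / N.+2%:R.
  by rewrite -[N.+1%:R in RHS](addrK 1) natr1 mulrBl divff ?mul1r// lt0r_neq0.
rewrite lnM ?posrE ?invr_gt0// lnV ?posrE// => ln_le.
by rewrite -lerBrDr (le_trans IH)// -addrA lerD2l -lerBlDl.
Qed.

Lemma integral_sumr (R : realType) d (T : measurableType d)
    (mu : {measure set T -> \bar R}) (r : seq nat) (f : nat -> T -> R) :
  (forall k, measurable_fun setT (f k)) -> (forall k w, 0 <= f k w) ->
  (\int[mu]_w (\sum_(k <- r) f k w)%:E = \sum_(k <- r) \int[mu]_w (f k w)%:E)%E.
Proof.
move=> mf f0; under eq_integral do rewrite -sumEFin.
rewrite ge0_integral_sum// => [k|k w _]; first exact/measurable_EFinP.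
by rewrite lee_fin.
Qed.

Section offspring.
Variable R : realType.
Context d (Omega : measurableType d) (P : probability Omega R).
Variable xi : nat -> nat -> nat -> nat -> Omega -> nat.

Definition offspring_family (ix : nat * nat * nat * nat) : Omega -> nat :=
  let: (i, k, m, l) := ix in xi i k m l.

Hypothesis nat_rv_xi : forall i k m l, nat_rv (xi i k m l).
Hypothesis independent_xi : mutually_independent P offspring_family.
Hypothesis xi_id : forall i k m l i' k' m' l' (A : set nat),
  P (xi i k m l @^-1` A) = P (xi i' k' m' l' @^-1` A).
Variable mu : R.
Hypothesis mu_gt0 : 0 < mu.
Hypothesis mean_xi : (\int[P]_w ((xi 1%N 0%N 0%N 0%N w)%:R : R)%:E)%E = mu%:E.

Lemma mean_offspring i k m l : (\int[P]_w ((xi i k m l w)%:R : R)%:E)%E = mu%:E.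
Proof.
by rewrite -mean_xi !nat_rv_expectation//; apply: eq_eseriesr => v _; exact: xi_id.
Qed.

Lemma mean_descendants i k m :
  (\int[P]_w ((descendants xi i k m w)%:R : R)%:E)%E = (mu ^+ m)%:E.
Proof.
apply: (@integral_GW R _ _ P _ offspring_family _ _ (fun m l => (i, k, m, l))) => //.
- by move=> [[[? ?] ?] ?]; exact: nat_rv_xi.
- by move=> ? ? ? ? [].
- by move=> m' l; exact: mean_offspring.
Qed.

Let term_ge0 i k m w : 0 <= (i%:R)^-1 * (descendants xi i k m w)%:R :> R.
Proof. by rewrite mulr_ge0// invr_ge0. Qed.

Let term_measurable i k m :
  measurable_fun setT (fun w => (i%:R)^-1 * (descendants xi i k m w)%:R : R).
Proof.
apply: measurable_funM => //; apply: nat_rv_measurable_fun.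
by apply: nat_rv_GW => *; exact: nat_rv_xi.
Qed.

Lemma measurable_weighted_progeny K N : measurable_fun setT (weighted_progeny xi R K N).
Proof. by do 3 (apply: measurable_sum => ?). Qed.

Lemma weighted_progeny_ge0 K N w : 0 <= weighted_progeny xi R K N w.
Proof. by do 3 (apply: sumr_ge0 => ? _). Qed.

Lemma integral_weighted_progeny K N : (\int[P]_w (weighted_progeny xi R K N w)%:E)%E =
  (\sum_(0 <= k < K) \sum_(1 <= i < N.+1) \sum_(0 <= m < K) (i%:R)^-1 * mu ^+ m)%:E.
Proof.
rewrite /weighted_progeny integral_sumr; last 2 first.
- by move=> k; do 2 (apply: measurable_sum => ?).
- by move=> k w; do 2 (apply: sumr_ge0 => ? _).
rewrite -sumEFin; apply: eq_bigr => k _; rewrite integral_sumr; last 2 first.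
- by move=> i; apply: measurable_sum => ?.
- by move=> i w; apply: sumr_ge0 => ? _.
rewrite -sumEFin; apply: eq_bigr => i _; rewrite integral_sumr// -sumEFin.
apply: eq_bigr => m _; under eq_integral do rewrite EFinM.
rewrite ge0_integralZl_EFin ?invr_ge0//; first by rewrite mean_descendants EFinM.
apply/measurable_EFinP/nat_rv_measurable_fun.
by apply: nat_rv_GW => *; exact: nat_rv_xi.
Qed.

Lemma mean_weighted_progeny_le K N : (\int[P]_w (weighted_progeny xi R K N w)%:E <=
  (K%:R * ((1 + ln N%:R) * (K%:R * Num.max 1 mu ^+ K)))%:E)%E.
Proof.
have geometric_le : \sum_(0 <= m < K) mu ^+ m <= K%:R * Num.max 1 mu ^+ K.
  apply: (@le_trans _ _ (\sum_(0 <= m < K) Num.max 1 mu ^+ K)); last first.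
    by rewrite big_const_nat subn0 iter_addr_0 mulr_natl.
  rewrite [leLHS]big_nat [leRHS]big_nat; apply: ler_sum => m /andP[_ mK].
  apply: (@le_trans _ _ (Num.max 1 mu ^+ m)).
    by apply: lerXn2r; rewrite ?nnegrE ?le_max ?lexx ?orbT ?ltW ?ler01.
  by apply: ler_weXn2l; [rewrite le_max lexx|exact: ltnW].
rewrite integral_weighted_progeny lee_fin.
rewrite [leLHS]big_const_nat subn0 iter_addr_0 -[leLHS]mulr_natl ler_wpM2l//.
under eq_bigr do rewrite -mulr_sumr.
rewrite -mulr_suml; apply: ler_pM (harmonic_le R N) geometric_le.
- by apply: sumr_ge0 => i _; rewrite invr_ge0.
- by apply: sumr_ge0 => m _; rewrite exprn_ge0// ltW.
Qed.

Lemma measurable_weighted_progeny_ge K N (c : R) :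
  measurable [set w | c <= weighted_progeny xi R K N w].
Proof.
have := measurable_weighted_progeny K N measurableT (measurable_itv `[c, +oo[).
by rewrite setTI; congr measurable; apply/seteqP; split => w /=; rewrite in_itv /= andbT.
Qed.

Lemma weighted_progeny_markov K N (c : R) : 0 < c ->
  (P [set w | (c <= weighted_progeny xi R K N w)%R] <=
   (K%:R * ((1 + ln N%:R) * (K%:R * Num.max 1 mu ^+ K)) / c)%:E)%E.
Proof.
move=> c0; have := mean_weighted_progeny_le K N.
have /measurable_EFinP mW := measurable_weighted_progeny K N.
have := le_integral_abse P measurableT mW c0; rewrite setTI /=.
under [in X in (_ <= X)%E]eq_integral do rewrite ger0_norm ?weighted_progeny_ge0//.
under eq_set do rewrite ger0_norm ?weighted_progeny_ge0// lee_fin.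
move=> /le_trans/[apply].
set E := [set w | _]; have PE : P E \is a fin_num.
  by apply: fin_num_measure; exact: measurable_weighted_progeny_ge.
by rewrite -(fineK PE) -EFinM !lee_fin ler_pdivlMr// mulrC.
Qed.

Definition offspring_prob : R := fine (P (xi 0 0 0 0 @^-1` [set n | (0 < n)%N])).

Lemma offspring_probE i k m l :
  P (xi i k m l @^-1` [set n | (0 < n)%N]) = offspring_prob%:E.
Proof.
rewrite (xi_id _ _ _ _ 0 0 0 0) /offspring_prob fineK// fin_num_measure//.
exact: nat_rv_xi.
Qed.

Lemma offspring_prob_gt0 : 0 < offspring_prob.
Proof.
rewrite lt_neqAle fine_ge0// andbT; apply/eqP => p0.
have : (\int[P]_w ((xi 0%N 0%N 0%N 0%N w)%:R : R)%:E = 0)%E.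
  rewrite nat_rv_expectation//; apply: eseries0 => v _ _.
  have P0 : P (xi 0 0 0 0 @^-1` [set n | (0 < n)%N]) = 0%E by rewrite offspring_probE -p0.
  apply/eqP; rewrite eq_le measure_ge0 andbT -P0.
  apply: le_measure; rewrite ?inE; [exact: nat_rv_xi|exact: nat_rv_xi|].
  by move=> w /=; exact: leq_ltn_trans.
by rewrite mean_offspring => -[muE]; have := mu_gt0; rewrite muE ltxx.
Qed.

Lemma offspring_prob_le1 : offspring_prob <= 1.
Proof.
rewrite -lee_fin -(offspring_probE 0 0 0 0); apply: probability_le1; exact: nat_rv_xi.
Qed.

Lemma measurable_line_survives K k i : measurable (line_survives xi K k i).
Proof.
by apply: fin_bigcap_measurable => [|m _]; [exact: finite_seq|exact: nat_rv_xi].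
Qed.

Lemma measurable_block_dies K r k c : measurable (block_dies xi K r k c).
Proof.
apply: fin_bigcap_measurable => [|i _]; first exact: finite_seq.
exact/measurableC/measurable_line_survives.
Qed.

Lemma lines_survive_prob K k s : uniq s ->
  P (\bigcap_(i in [set` s]) line_survives xi K k i) =
  (\prod_(i <- s) offspring_prob ^+ K)%:E.
Proof.
move=> us; pose lines := [seq (i, k, m, 0%N) | i <- s, m <- iota 0 K].
have ulines : uniq lines.
  by apply: allpairs_uniq => //; [exact: iota_uniq|move=> [? ?] [? ?] _ _ /= [-> ->]].
have := independent_xi (fun=> [set n | (0 < n)%N]) ulines.
rewrite (_ : [set w | _] = \bigcap_(i in [set` s]) line_survives xi K k i).
  move=> ->; rewrite /lines big_allpairs_dep -prodEFin; apply: eq_bigr => i _.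
  rewrite (eq_bigr (fun=> offspring_prob%:E)) => [|m _]; last exact: offspring_probE.
  by rewrite prodEFin big_const_seq count_predT size_iota iter_mulr_1.
apply/seteqP; split => w /= survive.
  by move=> i si m mK; apply: (survive (i, k, m, 0%N)); apply/allpairsPdep; exists i, m.
by move=> _ /allpairsPdep[i [m [si mK ->]]]; exact: survive.
Qed.

Lemma block_dies_prob K r k c :
  (P (block_dies xi K r k c) <= (expR (- (offspring_prob ^+ K * r%:R)))%:E)%E.
Proof.
have := prob_bigcap_setC (measurable_line_survives K k) (@lines_survive_prob K k)
  (iota_uniq (c * r).+1 r).
rewrite /block_dies => ->; rewrite big_const_seq count_predT size_iota iter_mulr_1.
rewrite lee_fin -mulNr expRM_natr.
apply: lerXn2r; rewrite ?nnegrE ?expR_ge0 ?expR_ge1Dx//.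
by rewrite subr_ge0 exprn_ile1// ?offspring_prob_le1// ltW// offspring_prob_gt0.
Qed.

End offspring.

(** * The points (k / n, log J_k / b_n) *)

Lemma cvgM_rescale (R : realType) (u v : nat -> R) (x y : R) :
  u n / n%:R @[n --> \oo] --> x -> n%:R * v n @[n --> \oo] --> y ->
  u n * v n @[n --> \oo] --> x * y.
Proof.
move=> ux vy; apply: cvg_trans (cvgM ux vy); apply: near_eq_cvg; near=> n.
have n0 : (n%:R : R) != 0.
  by rewrite lt0r_neq0// ltr0n; near: n; exact: nbhs_infty_gt.
by rewrite /= mulrA divfK.
Unshelve. all: by end_near. Qed.

Lemma cvg_pow_1B (R : realType) (x : nat -> R) (m : nat -> nat) (c : R) :
  (forall n, 0 <= x n) -> x n @[n --> \oo] --> 0 ->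
  (m n)%:R * x n @[n --> \oo] --> c ->
  (1 - x n) ^+ m n @[n --> \oo] --> expR (- c).
Proof.
move=> x_ge0 x_cvg0 mx_cvg.
have lower : expR (- ((m n)%:R * x n / (1 - x n))) @[n --> \oo] --> expR (- c).
  apply: continuous_cvg; first exact: continuous_expR.
  apply: cvgN; rewrite -[X in _ --> X]divr1; apply: cvgM => //.
  apply: cvgV; first exact: oner_neq0.
  by rewrite -[X in _ --> X]subr0; apply: cvgB => //; exact: cvg_cst.
have upper : expR (- ((m n)%:R * x n)) @[n --> \oo] --> expR (- c).
  by apply: continuous_cvg; [exact: continuous_expR|exact: cvgN].
apply: (squeeze_cvgr _ lower upper); near=> n.
have x_lt1 : x n < 1 by near: n; apply: (cvgr_lt _ x_cvg0).
have x1 : 0 < 1 - x n by rewrite subr_gt0.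
have expR_pow y : expR (- ((m n)%:R * y)) = expR (- y) ^+ m n.
  by rewrite -mulrN mulrC expRM_natr.
rewrite -mulrA !expR_pow.
apply/andP; split; apply: lerXn2r; rewrite ?nnegrE ?expR_ge0 ?expR_ge1Dx ?(ltW x1)//.
rewrite expRN -[leRHS]invrK lef_pV2 ?posrE ?expR_gt0 ?invr_gt0//.
apply: le_trans (expR_ge1Dx _); rewrite -[leLHS]div1r ler_pdivrMr//.
by rewrite mulrDl mul1r divfK ?lt0r_neq0// subrK.
Unshelve. all: by end_near. Qed.

Lemma expRN_lt_quadratic (R : realType) (x : R) : 0 < x -> expR (- x) < 1 - x + x ^+ 2.
Proof.
move=> x0; rewrite expRN -div1r ltr_pdivrMr ?expR_gt0//.
apply: (@lt_le_trans _ _ ((1 - x + x ^+ 2) * (1 + x))).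
  have -> : (1 - x + x ^+ 2) * (1 + x) = 1 + x ^+ 3 by ring.
  by rewrite ltrDl exprn_gt0.
by rewrite ler_wpM2l ?expR_ge1Dx//; nra.
Qed.

Section bonferroni.
Local Open Scope ereal_scope.
Context d (T : measurableType d) (R : realType) (P : probability T R).

Lemma prob_two_add_union_le (E : nat -> set T) n : (forall k, measurable (E k)) ->
  P (\bigcup_(k < n) \bigcup_(k' < k) (E k' `&` E k)) + P (\bigcup_(k < n) E k) <=
  \sum_(k < n) P (E k).
Proof.
move=> mE.
have mU m : measurable (\bigcup_(k < m) E k) by exact: bigcup_measurable.
have mtwo k : measurable (\bigcup_(k' < k) (E k' `&` E k)).
  by apply: bigcup_measurable => k' _; exact: measurableI.
elim: n => [|n IH]; first by rewrite II0 !bigcup_set0 big_ord0 !measure0 adde0.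
rewrite big_ord_recr/= IIS !bigcup_setU !bigcup_set1 -setI_bigcupl.
set U := \bigcup_(k < n) E k; set two := \bigcup_(k < n) _.
have fineP A : measurable A -> (fine (P A))%:E = P A.
  by move=> mA; rewrite fineK ?fin_num_measure.
have mtwos : measurable two by exact: bigcup_measurable.
have mUn : measurable U by exact: mU.
have mUE : measurable (U `&` E n) by exact: measurableI.
have two_le : P (two `|` (U `&` E n)) <= P two + P (U `&` E n) by exact: measureU2.
have unionE : P (U `|` E n) = P U + P (E n) - P (U `&` E n).
  by apply: measureUfinl => //; rewrite ltey_eq fin_num_measure.
rewrite unionE (le_trans (leeD2r _ two_le))//.
apply: (@le_trans _ _ (P two + P U + P (E n))); last exact: leeD2r.
rewrite -(fineP two)// -(fineP U)// -(fineP (E n))// -(fineP (U `&` E n))//.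
by rewrite -!EFinD lee_fin; lra.
Qed.

End bonferroni.

Section column_indices.
Variable R : realType.
Implicit Types (n k a : nat) (h s : R).

Definition count_before n s : nat := `|Num.ceil (n%:R * s)|%N.

Lemma lt_count_before n k s : (0 < n)%N -> 0 <= s ->
  (k < count_before n s)%N = (k%:R / n%:R < s).
Proof.
move=> n0 s0; have n0R : (0 : R) < n%:R by rewrite ltr0n.
have ceil0 : 0 <= Num.ceil (n%:R * s).
  by rewrite ceil_ge0 (lt_le_trans (ltrN10 R))// mulr_ge0.
rewrite ltr_pdivrMr// mulrC -ltz_nat /count_before gez0_abs//.
by rewrite ceil_gt_int.
Qed.

Lemma count_before_ge n s : 0 <= s -> n%:R * s <= (count_before n s)%:R.
Proof.
move=> s0; have ns0 : 0 <= n%:R * s by rewrite mulr_ge0.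
rewrite /count_before natr_absz ger0_norm ?ceil_ge// ceil_ge0.
exact: lt_le_trans (ltrN10 R) ns0.
Qed.

Lemma count_before_lt n s : 0 <= s -> (count_before n s)%:R < n%:R * s + 1.
Proof.
move=> s0; have ns0 : 0 <= n%:R * s by rewrite mulr_ge0.
rewrite /count_before natr_absz ger0_norm; last first.
  by rewrite ceil_ge0 (lt_le_trans (ltrN10 R)).
by have := ceilB1_lt (n%:R * s); rewrite intrB ltrBlDr.
Qed.

Lemma leq_count_before n s s' : 0 <= s -> s <= s' ->
  (count_before n s <= count_before n s')%N.
Proof.
move=> s0 ss'; rewrite -ltnS -(ltr_nat R) -natr1.
apply: (lt_le_trans (count_before_lt n s0)); rewrite lerD2r.
by apply: le_trans (count_before_ge n (le_trans s0 ss')); rewrite ler_wpM2l.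
Qed.

Lemma count_before_cvg s : 0 <= s -> (count_before n s)%:R / n%:R @[n --> \oo] --> s.
Proof.
move=> s0; apply/cvgrPdist_le => e e0; near=> n.
have n0 : (0 : R) < n%:R by rewrite ltr0n; near: n; exact: nbhs_infty_gt.
have ne : 1 <= e * n%:R.
  by rewrite -ler_pdivrMl// mulr1; near: n; exact: nbhs_infty_ger.
rewrite distrC -[X in _ - X](mulfK (lt0r_neq0 n0)) -mulrBl normrM.
rewrite [X in _ * X]gtr0_norm ?invr_gt0// ler_pdivrMr// (le_trans _ ne)//.
have := count_before_ge n s0; have := count_before_lt n s0.
by rewrite ler_norml; lra.
Unshelve. all: by end_near. Qed.

Definition column_count n h a : nat :=
  (count_before n (a.+1%:R * h) - count_before n (a%:R * h))%N.

Lemma in_columnE n k h a : (0 < n)%N -> 0 < h -> in_column h a (k%:R / n%:R) =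
  (count_before n (a%:R * h) <= k < count_before n (a.+1%:R * h))%N.
Proof.
move=> n0 h0; rewrite leqNgt !lt_count_before ?mulr_ge0 ?(ltW h0)//.
by rewrite -leNgt.
Qed.

Lemma column_count_cvg h a : 0 < h -> (column_count n h a)%:R / n%:R @[n --> \oo] --> h.
Proof.
move=> h0; have pos b : 0 <= b%:R * h by rewrite mulr_ge0// ltW.
have diff_cvg : (count_before n (a.+1%:R * h))%:R / n%:R -
    (count_before n (a%:R * h))%:R / n%:R @[n --> \oo] --> a.+1%:R * h - a%:R * h.
  by apply: cvgB; exact: count_before_cvg.
have widthE : a.+1%:R * h - a%:R * h = h.
  by rewrite -mulrBl -natr1 addrAC subrr add0r mul1r.
rewrite widthE in diff_cvg.
apply: cvg_trans diff_cvg; apply: near_eq_cvg; apply: nearW => n.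
by rewrite /column_count natrB ?mulrBl// leq_count_before// ler_pM2r// ler_nat.
Qed.

End column_indices.

Section immigration.
Variable R : realType.
Context d (Omega : measurableType d) (P : probability Omega R).
Variable J : nat -> Omega -> nat.
Hypothesis nat_rv_J : forall k, nat_rv (J k).
Hypothesis J_id : forall k k' (A : set nat), P (J k @^-1` A) = P (J k' @^-1` A).

Definition log_tail (x : R) : R := fine (P [set w | x < ln (J 0%N w)%:R]).

Lemma measurable_log_gt k x : measurable [set w | x < ln ((J k w)%:R : R)].
Proof. exact: (nat_rv_J k [set n | x < ln n%:R]). Qed.

Lemma log_tailE k x : P [set w | x < ln ((J k w)%:R : R)] = (log_tail x)%:E.
Proof.
rewrite (J_id k 0%N [set n | x < ln n%:R]) /log_tail fineK//.
by apply: fin_num_measure; exact: measurable_log_gt.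
Qed.

Lemma log_tail_ge0 x : 0 <= log_tail x. Proof. exact: fine_ge0. Qed.

Lemma log_tail_nincr : {homo log_tail : x y /~ x <= y}.
Proof.
move=> x y yx; rewrite -lee_fin -!(log_tailE 0).
apply: le_measure; rewrite ?inE; try exact: measurable_log_gt.
by move=> w /=; exact: le_lt_trans.
Qed.

Hypothesis independent_J : mutually_independent P J.
Variables (alpha : R) (b : nat -> R).
Hypothesis b_gt0 : forall n, (0 < n)%N -> 0 < b n.
Hypothesis tail_cvg : forall y : R, 0 < y ->
  n%:R * log_tail (y * b n) @[n --> \oo] --> y `^ (- alpha).

Lemma tail_cvg0 y : 0 < y -> log_tail (y * b n) @[n --> \oo] --> 0.
Proof.
move=> y0; have invn_cvg0 : 1 / n%:R @[n --> \oo] --> (0 : R).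
  under eq_fun do rewrite div1r; apply/gtr0_cvgV0; last exact: cvgr_idn.
  by near=> n; rewrite ltr0n; near: n; exact: nbhs_infty_gt.
have := cvgM_rescale invn_cvg0 (tail_cvg y0); rewrite mul0r.
by under eq_fun do rewrite mul1r.
Unshelve. all: by end_near. Qed.

Lemma column_tail_cvg h a y : 0 < h -> 0 < y ->
  (column_count n h a)%:R * log_tail (y * b n) @[n --> \oo] --> h * y `^ (- alpha).
Proof.
by move=> h0 y0; apply: cvgM_rescale; [exact: column_count_cvg|exact: tail_cvg].
Qed.

Definition point_time (n k : nat) (w : Omega) : R := k%:R / n%:R.
Definition point_mark (n k : nat) (w : Omega) : \bar R := (ln (J k w)%:R / b n)%:E.

Lemma measurable_point_time n k : measurable_fun setT (point_time n k).
Proof. exact: measurable_cst. Qed.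

Lemma measurable_point_mark n k : measurable_fun setT (point_mark n k).
Proof.
move=> _ A mA; rewrite setTI.
exact: (nat_rv_J k [set x : nat | A (ln (x%:R : R) / b n)%:E]).
Qed.

Lemma point_mark_gt n k w y : (0 < n)%N ->
  (y%:E < point_mark n k w)%E = (y * b n < ln (J k w)%:R).
Proof. by move=> n0; rewrite lte_fin ltr_pdivlMr// b_gt0. Qed.

Lemma early_point_le n e : (0 < n)%N ->
  (P (early_point (point_time n) (point_mark n) e) <= (log_tail (e * b n))%:E)%E.
Proof.
move=> n0; rewrite -(log_tailE 0); apply: le_measure; rewrite ?inE.
- apply: measurable_early_point => k;
    [exact: measurable_point_time|exact: measurable_point_mark].
- exact: measurable_log_gt.
move=> w [k _ [k0]]; rewrite point_mark_gt//; move: k0.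
rewrite /point_time pmulr_lle0 ?invr_gt0 ?ltr0n//.
by rewrite lern0 => /eqP ->.
Qed.

Lemma no_mark_above_prob n h A (D : pred 'I_A) (y : 'I_A -> R) k : (0 < n)%N -> 0 < h ->
  P (J k @^-1` [set x | forall a, D a -> in_column h a (k%:R / n%:R : R) ->
      ln (x%:R : R) <= y a * b n]) =
  (\prod_(a | D a) (if in_column h a (k%:R / n%:R : R)
     then 1 - log_tail (y a * b n) else 1))%:E.
Proof.
move=> n0 h0.
have [[a /andP[Da ka]]|free] := pselect (exists a, D a && in_column h a (k%:R / n%:R : R)).
  have unique (a' : 'I_A) : in_column h a' (k%:R / n%:R : R) -> a' = a.
    by move=> ka'; apply/val_inj; exact: in_column_inj h0 ka' ka.
  rewrite (bigD1 a)//= ka big1 ?mulr1 => [|a' /andP[_ a'a]]; last first.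
    by case: ifP => // /unique a'E; rewrite a'E eqxx in a'a.
  rewrite EFinB -(log_tailE k) -probability_setC; last exact: measurable_log_gt.
  congr (P _); apply/seteqP; split => w /=.
    by move=> low; apply/negP; rewrite -leNgt; exact: low.
  by move=> /negP; rewrite -leNgt => low a' _ /unique ->.
rewrite big1 => [|a Da]; last first.
  by case: ifP => // ka; exfalso; apply: free; exists a; rewrite Da.
rewrite -(@probability_setT _ _ _ P); congr (P _); apply/seteqP; split => // w _ a Da ka.
by exfalso; apply: free; exists a; rewrite Da.
Qed.

Lemma void_columns_prob n h A (D : pred 'I_A) (y : 'I_A -> R) : (0 < n)%N -> 0 < h ->
  fine (P (void_columns (point_time n) (point_mark n) h D y)) =
  \prod_(a | D a) (1 - log_tail (y a * b n)) ^+ column_count n h a.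
Proof.
move=> n0 h0; pose K := count_before n (A%:R * h).
pose low k := [set x : nat | forall a, D a -> in_column h a (k%:R / n%:R : R) ->
  ln (x%:R : R) <= y a * b n].
have -> : void_columns (point_time n) (point_mark n) h D y =
    [set w | forall k, k \in index_iota 0 K -> low k (J k w)].
  apply/seteqP; split => w /= void.
    move=> k _ a Da ka; have := void a Da k ka.
    by rewrite leNgt point_mark_gt// -leNgt.
  move=> a Da k ka; rewrite leNgt point_mark_gt// -leNgt; apply: void => //.
  have := ka; rewrite /point_time in_columnE// mem_index_iota /= => /andP[_ kc].
  apply: (leq_trans kc); apply: leq_count_before; first by rewrite mulr_ge0// ltW.
  by rewrite ler_pM2r// ler_nat ltn_ord.
rewrite (independent_J low (iota_uniq 0 (K - 0))).
rewrite (eq_bigr _ (fun k _ => no_mark_above_prob D y k n0 h0)) prodEFin /=.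
rewrite exchange_big /=; apply: eq_bigr => a Da.
rewrite -prodr_const_nat [RHS](big_nat_widenl _ 0)// [RHS](big_nat_widen _ _ K).
  by rewrite [RHS]big_mkcond; apply: eq_bigr => k _; rewrite in_columnE.
apply: leq_count_before; first by rewrite mulr_ge0// ltW.
by rewrite ler_pM2r// ler_nat ltn_ord.
Qed.

Lemma void_columns_cvg h A (D : pred 'I_A) (y : 'I_A -> R) :
  0 < h -> (forall a, 0 < y a) ->
  fine (P (void_columns (point_time n) (point_mark n) h D y)) @[n --> \oo] -->
  expR (- \sum_(a | D a) h * y a `^ (- alpha)).
Proof.
move=> h0 y0; rewrite -sumrN expR_sum.
have prod_cvg : \prod_(a | D a) (1 - log_tail (y a * b n)) ^+ column_count n h a
    @[n --> \oo] --> \prod_(a | D a) expR (- (h * y a `^ (- alpha))).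
  apply: cvg_big => [|a Da]; first exact: mul_continuous.
  apply: cvg_pow_1B => [n||]; [exact: log_tail_ge0|exact: tail_cvg0|].
  exact: column_tail_cvg.
apply: cvg_trans prod_cvg; apply: near_eq_cvg; near=> n.
by rewrite void_columns_prob//; near: n; exact: nbhs_infty_gt.
Unshelve. all: by end_near. Qed.

Lemma crowded_column_le n h e a : (0 < n)%N -> 0 < h ->
  (P (crowded_column (point_time n) (point_mark n) h e a) <=
   ((column_count n h a)%:R * log_tail (e * b n) -
    (1 - fine (P (void_columns (point_time n) (point_mark n) h
      (pred1 (@ord_max a)) (fun=> e)))))%:E)%E.
Proof.
move=> n0 h0; pose c := count_before n (a%:R * h).
pose E i := [set w | e * b n < ln ((J (c + i)%N w)%:R : R)].
have mE i : measurable (E i) by exact: measurable_log_gt.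
have mt k : measurable_fun setT (point_time n k) by exact: measurable_point_time.
have mj k : measurable_fun setT (point_mark n k) by exact: measurable_point_mark.
have large_pointE k w : large_point (point_time n) (point_mark n) h e a k w ->
    exists i, [/\ (i < column_count n h a)%N, k = (c + i)%N & E i w].
  rewrite /large_point /= /point_time in_columnE// => -[/andP[ck kc]].
  rewrite point_mark_gt// => kj; exists (k - c)%N; rewrite /E subnKC//=.
  by split=> //; rewrite ltn_sub2r// (leq_ltn_trans ck).
have unionE : \bigcup_(i < column_count n h a) E i = ~` void_columns (point_time n)
    (point_mark n) h (pred1 (@ord_max a)) (fun=> e).
  apply/seteqP; split=> w /=.
    move=> [i ic Ei] /(_ ord_max (eqxx _) (c + i)%N); rewrite leNgt point_mark_gt// Ei.
    rewrite /point_time in_columnE// leq_addr -ltn_subRL ic.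
    by move=> /(_ isT).
  move=> crowd; apply: contrapT => no_large; apply: crowd => _ /eqP -> k ka.
  rewrite leNgt; apply/negP => kj.
  have [i [ic _ Ei]] := large_pointE k w (conj ka kj).
  by apply: no_large; exists i.
have m_two : measurable (\bigcup_(k < column_count n h a) \bigcup_(k' < k) (E k' `&` E k)).
  by do 2 (apply: bigcup_measurable => ? _); exact: measurableI.
have crowded_le : (P (crowded_column (point_time n) (point_mark n) h e a) <=
    P (\bigcup_(k < column_count n h a) \bigcup_(k' < k) (E k' `&` E k)))%E.
  apply: le_measure; rewrite ?inE//; first exact: measurable_crowded_column.
  move=> w [k _ [k' kk' [/large_pointE[i [ic kE Ei]] /large_pointE[i' [ic' k'E Ei']]]]].
  by exists i' => //; exists i => //=; move: kk'; rewrite /= kE k'E ltn_add2l.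
apply: (le_trans crowded_le).
have m_void := measurable_void_columns mt mj h (pred1 (@ord_max a)) (fun=> e).
have := prob_two_add_union_le P (column_count n h a) mE.
under eq_bigr do rewrite log_tailE.
rewrite sumEFin sumr_const card_ord -[X in (_ <= X%:E)%E -> _]mulr_natl unionE.
rewrite probability_setC// -{1}[P (void_columns _ _ _ _ _)]fineK ?fin_num_measure//.
rewrite -[P (\bigcup_(_ < _) _)]fineK ?fin_num_measure// -EFinB -EFinD !lee_fin.
by lra.
Qed.

Lemma near_crowded_column_le h e a : 0 < h -> 0 < e -> \forall n \near \oo,
  (P (crowded_column (point_time n) (point_mark n) h e a) <=
   ((h * e `^ (- alpha)) ^+ 2)%:E)%E.
Proof.
move=> h0 e0; set lam := h * e `^ (- alpha).
have lam0 : 0 < lam by rewrite mulr_gt0// powR_gt0.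
have bound_cvg : (column_count n h a)%:R * log_tail (e * b n) -
    (1 - fine (P (void_columns (point_time n) (point_mark n) h
      (pred1 (@ord_max a)) (fun=> e)))) @[n --> \oo] --> lam - (1 - expR (- lam)).
  apply: cvgB; first exact: column_tail_cvg.
  apply: cvgB; first exact: cvg_cst.
  have := void_columns_cvg (D := pred1 (@ord_max a)) (y := fun=> e) h0 (fun=> e0).
  by rewrite big_pred1_eq.
have bound_lt : lam - (1 - expR (- lam)) < lam ^+ 2.
  by have := expRN_lt_quadratic lam0; lra.
near=> n; have n0 : (0 < n)%N by near: n; exact: nbhs_infty_gt.
apply: (le_trans (crowded_column_le _ _ n0 h0)); rewrite lee_fin.
by near: n; exact: (cvgr_le _ bound_cvg).
Unshelve. all: by end_near. Qed.

Lemma points_asymptotically_poisson :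
  asymptotically_poisson alpha P point_time point_mark.
Proof.
split.
- exact: measurable_point_time.
- exact: measurable_point_mark.
- by move=> h A D y; exact: void_columns_cvg.
- by move=> h e a; exact: near_crowded_column_le.
- move=> e p e0 p0; near=> n.
  have n0 : (0 < n)%N by near: n; exact: nbhs_infty_gt.
  apply: (le_trans (early_point_le e n0)); rewrite lee_fin.
  by near: n; exact: (cvgr_le _ (tail_cvg0 e0)).
Unshelve. all: by end_near. Qed.

End immigration.

(** * The process follows the running maximum of the points *)

Section deterministic_tracking.
Variable R : realType.

Lemma tracks_of_log_bounds (T e b : R) (n : nat) (Y J : nat -> nat) :
  (0 < n)%N -> 0 < b -> 0 < e ->
  (forall m, m%:R / n%:R < T ->
    (forall k, (k <= m)%N -> ln ((J k)%:R : R) <= logp (Y m)%:R + e * b) /\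
    ((0 < Y m)%N -> exists2 k, (k <= m)%N & ln ((Y m)%:R : R) <= ln (J k)%:R + e * b)) ->
  tracks T e (fun k => k%:R / n%:R) (fun k => (ln (J k)%:R / b)%:E)
    (fun t => logp (Y (Num.truncn (n%:R * t)))%:R / b).
Proof.
move=> n0 b0 e0 bounds u /andP[u0 uT]; have n0R : (0 : R) < n%:R by rewrite ltr0n.
have nu0 : 0 <= n%:R * u by rewrite mulr_ge0// ltW.
set m := Num.truncn (n%:R * u).
have le_mE k : (k <= m)%N = (k%:R / n%:R <= u).
  by rewrite /m truncn_ge_nat// ler_pdivrMr// mulrC.
have [|lower upper] := bounds m; first by apply: le_lt_trans uT; rewrite -le_mE.
have logY0 : 0 <= logp ((Y m)%:R : R) by rewrite /logp le_max lexx orbT.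
split.
- by rewrite (@le_trans _ _ 0) ?oppr_le0 ?divr_ge0// ltW.
- move=> k; rewrite -le_mE => /lower Jk.
  by rewrite lee_fin ler_pdivrMr// mulrDl divfK// lt0r_neq0.
- have [Y0|/[dup] Y0 /upper[k km Yk]] := posnP (Y m).
    by left; rewrite Y0 /logp ln0// maxxx mul0r ltW.
  right; exists k; first by rewrite -le_mE.
  rewrite lee_fin ler_pdivlMr// mulrBl divfK ?lt0r_neq0// lerBlDr.
  by rewrite /logp max_l// ln_ge0// ler1n.
Qed.

Lemma ln_le_logp_quotient (r x y : nat) : (0 < r)%N -> (x %/ r <= y)%N ->
  ln (x%:R : R) <= logp y%:R + ln (2 * r%:R).
Proof.
move=> r0 xry; have y1 : (0 < maxn y 1)%N by rewrite leq_max orbT.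
have x_le : (x <= 2 * r * maxn y 1)%N.
  have : (x < y.+1 * r)%N by rewrite -ltn_divLR.
  move=> /ltnW/leq_trans; apply; rewrite mulnC -mulnA mulnCA leq_mul2l.
  apply/orP; right; rewrite mul2n -addnn -addn1 leq_add// leq_max leqnn ?orbT//.
have -> : logp (y%:R : R) = ln (maxn y 1)%:R.
  rewrite /logp; case: y {xry y1 x_le} => [|y].
    by rewrite max0n ln0// ln1 maxxx.
  by rewrite (maxn_idPl _)// max_l// ln_ge0// ler1n.
have r0R : (0 : R) < r%:R by rewrite ltr0n.
have y1R : (0 : R) < (maxn y 1)%:R by rewrite ltr0n.
have [->|x0] := posnP x.
  by rewrite ln0// addr_ge0// ln_ge0// -?natrM ler1n// muln_gt0.
rewrite addrC -lnM ?posrE ?mulr_gt0// ler_ln ?posrE ?mulr_gt0 ?ltr0n//.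
by rewrite -!natrM ler_nat.
Qed.

Variables (Omega : Type) (xi : nat -> nat -> nat -> nat -> Omega -> nat).
Variables (J : nat -> Omega -> nat).

Lemma ln_immigrants_le (K N r m k : nat) (w : Omega) : (0 < r)%N -> (m < K)%N ->
  (k <= m)%N -> (J k w <= N)%N ->
  (forall c, (c < N)%N -> ~ block_dies xi K r k c w) ->
  ln ((J k w)%:R : R) <= logp (GWI xi J m w)%:R + ln (2 * r%:R).
Proof.
move=> r0 mK km JN alive; apply: ln_le_logp_quotient => //.
apply: (@GWI_ge_blocks _ _ _ _ K) => //; first exact: ltnW.
move=> c cJ; apply: alive; apply: (leq_trans cJ).
exact: leq_trans (leq_div _ _) JN.
Qed.

Lemma ln_GWI_le (K N m : nat) (W : R) (w : Omega) : (m < K)%N ->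
  (forall k, (k <= m)%N -> (J k w <= N)%N) -> weighted_progeny xi R K N w <= W ->
  (0 < GWI xi J m w)%N ->
  exists2 k, (k <= m)%N & ln ((GWI xi J m w)%:R : R) <= ln (J k w)%:R + ln W.
Proof.
move=> mK JN WW Y0; have := @GWI_le_weighted _ xi J w R K N m mK JN.
have [|k ->] := @bigop.eq_bigmax _ (fun k : 'I_m.+1 => J k w).
  by rewrite card_ord.
move=> YW; have {}YW := le_trans YW (ler_wpM2l (ler0n _ _) WW).
have JW0 : 0 < (J k w)%:R * W by apply: lt_le_trans YW; rewrite ltr0n.
have J0 : 0 < (J k w)%:R :> R.
  by rewrite lt0r ler0n andbT; apply/negP => /eqP J0; rewrite J0 mul0r ltxx in JW0.
have W0 : 0 < W by rewrite pmulr_rgt0 in JW0.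
exists k; first by rewrite -ltnS.
by rewrite -lnM ?posrE// ler_ln ?posrE ?ltr0n.
Qed.

End deterministic_tracking.

Section horizon_estimates.
Variables (R : realType) (b : nat -> R) (K : nat -> nat).
Hypothesis b_cvg_pinfty : b n @[n --> \oo] --> +oo.
Hypothesis K_small : (K n)%:R / b n @[n --> \oo] --> 0.

Let near_b_ge C : \forall n \near \oo, C <= b n.
Proof. by move/cvgryPge : b_cvg_pinfty; apply; exact: num_real. Qed.

Lemma near_horizon_le (c eta : R) : 0 <= c -> 0 < eta ->
  \forall n \near \oo, c * (K n)%:R <= eta * b n.
Proof.
move=> c0 eta0; near=> n.
have b0 : 0 < b n by apply: lt_le_trans ltr01 _; near: n; exact: near_b_ge.
have : (K n)%:R / b n <= eta / (c + 1).
  by near: n; apply: (cvgr_le _ K_small); rewrite divr_gt0// ltr_wpDl.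
rewrite ler_pdivrMr// mulrAC ler_pdivlMr ?ltr_wpDl//.
have : 0 <= (K n)%:R :> R by []; lra.
Unshelve. all: by end_near. Qed.

Lemma near_linear_le_expR (C eta : R) : 0 < eta ->
  \forall n \near \oo, C * b n <= expR (eta * b n).
Proof.
move=> eta0; near=> n.
have b0 : 0 < b n by apply: lt_le_trans ltr01 _; near: n; exact: near_b_ge.
have : 2 * C / eta ^+ 2 <= b n by near: n; exact: near_b_ge.
rewrite ler_pdivrMr ?exprn_gt0// => /(ler_wpM2r (ltW b0)) Cb.
have := expR_ge1Dxn 1 (ltW (mulr_gt0 eta0 b0)).
by rewrite exprMn -[2`!]/2%N; lra.
Unshelve. all: by end_near. Qed.

Lemma expRN_cvg0 (eta : R) : 0 < eta -> expR (- (eta * b n)) @[n --> \oo] --> 0.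
Proof.
move=> eta0; have eta_b : eta * b n @[n --> \oo] --> +oo.
  apply/cvgryPge => C; near=> n; rewrite mulrC -ler_pdivrMr//.
  by near: n; exact: near_b_ge.
exact: (cvg_comp _ _ eta_b (@cvgr_expR R)).
Unshelve. all: by end_near. Qed.

Lemma near_progeny_mean_le (mu H del p : R) : 0 < del -> 0 < p ->
  \forall n \near \oo, forall x : R, x <= H * b n ->
  (K n)%:R * ((1 + x) * ((K n)%:R * Num.max 1 mu ^+ K n)) / expR (del * b n) <= p.
Proof.
move=> del0 p0; have del4 : 0 < del / 4 by rewrite divr_gt0.
set M := Num.max 1 mu; have M1 : 1 <= M by rewrite le_max lexx.
have lnM0 : 0 <= ln M by exact: ln_ge0.
near=> n => x xH.
have growth : (2 + ln M) * (K n)%:R <= del / 4 * b n.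
  by near: n; apply: near_horizon_le => //; lra.
have linear : 1 + x <= expR (del / 4 * b n).
  apply: (@le_trans _ _ ((1 + `|H|) * b n)); last first.
    by near: n; exact: near_linear_le_expR.
  have b1 : 1 <= b n by near: n; exact: near_b_ge.
  have := ler_norm H; have : 0 <= `|H| by []; nra.
have decay : expR (- (del / 2 * b n)) <= p.
  by near: n; apply: (cvgr_le _ (expRN_cvg0 _)); rewrite ?divr_gt0.
have KM : (K n)%:R * ((K n)%:R * M ^+ K n) <= expR (del / 4 * b n).
  have K_le : (K n)%:R <= expR (K n)%:R :> R.
    by apply: le_trans (expR_ge1Dx _); rewrite lerDr.
  apply: (@le_trans _ _ (expR (K n)%:R * (expR (K n)%:R * expR (ln M * (K n)%:R)))).
    have M_pow : M ^+ K n = expR (ln M * (K n)%:R).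
      by rewrite expRM_natr lnK// posrE (lt_le_trans ltr01).
    by rewrite M_pow !ler_pM ?mulr_ge0 ?expR_ge0.
  by rewrite -!expRD ler_expR; lra.
rewrite ler_pdivrMr ?expR_gt0// mulrCA.
apply: (@le_trans _ _ (expR (del / 4 * b n) * expR (del / 4 * b n))).
  apply: (@le_trans _ _ (expR (del / 4 * b n) *
      ((K n)%:R * ((K n)%:R * M ^+ K n)))).
    by rewrite ler_wpM2r// !mulr_ge0// exprn_ge0// (le_trans ler01).
  by rewrite ler_wpM2l// expR_ge0.
apply: (@le_trans _ _ (expR (- (del / 2 * b n)) * expR (del * b n))).
  by rewrite -!expRD ler_expR; lra.
by rewrite ler_wpM2r// expR_ge0.
Unshelve. all: by end_near. Qed.

Lemma near_extinction_le (q H del p : R) : 0 < q <= 1 -> 0 < del -> 0 < p ->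
  \forall n \near \oo, forall N r : nat, N%:R <= expR (H * b n) ->
  expR (del * b n) <= r%:R ->
  (K n)%:R * (N%:R * expR (- (q ^+ K n * r%:R))) <= p.
Proof.
move=> /andP[q0 q1] del0 p0; have del2 : 0 < del / 2 by rewrite divr_gt0.
have lnq0 : 0 <= - ln q by rewrite oppr_ge0 ln_le0.
near=> n => N r N_le r_ge.
have K_le : (K n)%:R <= expR (b n).
  have : 1 * (K n)%:R <= 1 * b n by near: n; exact: near_horizon_le.
  by have := expR_ge1Dx (b n); lra.
have lines_ge : expR (del / 2 * b n) <= q ^+ K n * r%:R.
  apply: (@le_trans _ _ (expR (ln q * (K n)%:R) * expR (del * b n))).
    rewrite -expRD ler_expR.
    have : - ln q * (K n)%:R <= del / 2 * b n by near: n; exact: near_horizon_le.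
    by lra.
  by rewrite expRM_natr lnK// ler_wpM2l// exprn_ge0// ltW.
have quad : (2 + H) * b n <= expR (del / 2 * b n).
  by near: n; exact: near_linear_le_expR.
have decay : expR (- (1 * b n)) <= p.
  by near: n; apply: (cvgr_le _ (expRN_cvg0 _)).
apply: le_trans decay.
apply: (@le_trans _ _ (expR (b n) * (expR (H * b n) * expR (- ((2 + H) * b n))))).
  rewrite !ler_pM ?mulr_ge0 ?expR_ge0//.
  by rewrite ler_expR lerN2 (le_trans quad).
by rewrite -!expRD ler_expR; lra.
Unshelve. all: by end_near. Qed.

End horizon_estimates.

Section population_tracking.
Variable R : realType.
Context d (Omega : measurableType d) (P : probability Omega R).
Variables (xi : nat -> nat -> nat -> nat -> Omega -> nat) (J : nat -> Omega -> nat).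
Variables (mu : R) (b : nat -> R).
Hypothesis nat_rv_xi : forall i k m l, nat_rv (xi i k m l).
Hypothesis independent_xi : mutually_independent P (offspring_family xi).
Hypothesis xi_id : forall i k m l i' k' m' l' (A : set nat),
  P (xi i k m l @^-1` A) = P (xi i' k' m' l' @^-1` A).
Hypothesis mu_gt0 : 0 < mu.
Hypothesis mean_xi : (\int[P]_w ((xi 1%N 0%N 0%N 0%N w)%:R : R)%:E)%E = mu%:E.
Hypothesis b_gt0 : forall n, (0 < n)%N -> 0 < b n.
Hypothesis b_cvg_pinfty : b n @[n --> \oo] --> +oo.
Hypothesis b_superlinear : n%:R / b n @[n --> \oo] --> (0 : R).

Section horizon.
Variables (T e H : R).
Hypotheses (T_gt0 : 0 < T) (e_gt0 : 0 < e) (H_gt0 : 0 < H).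

Definition horizon (n : nat) : nat := count_before n T.
Definition immigrant_bound (n : nat) : nat := Num.truncn (expR (H * b n)).
Definition block_size (n : nat) : nat := (Num.truncn (expR (e / 2 * b n))).+1.

Definition large_progeny (n : nat) : set Omega :=
  [set w | expR (e / 2 * b n) <=
     weighted_progeny xi R (horizon n) (immigrant_bound n) w].

Definition dead_block (n : nat) : set Omega :=
  \bigcup_(k < horizon n) \bigcup_(c < immigrant_bound n)
    block_dies xi (horizon n) (block_size n) k c.

Let e2_gt0 : 0 < e / 2. Proof. by rewrite divr_gt0. Qed.

Lemma horizon_small : (horizon n)%:R / b n @[n --> \oo] --> 0.
Proof.
rewrite -(mulr0 T); apply: (cvgM_rescale (v := fun n => (b n)^-1)) => //.
exact: count_before_cvg (ltW T_gt0).
Qed.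

Lemma immigrant_bound_le n : (immigrant_bound n)%:R <= expR (H * b n).
Proof. by rewrite truncn_le expR_ge0. Qed.

Lemma measurable_large_progeny n : measurable (large_progeny n).
Proof. exact: measurable_weighted_progeny_ge. Qed.

Lemma measurable_bigcup_block_dies n k : measurable (\bigcup_(c < immigrant_bound n)
  block_dies xi (horizon n) (block_size n) k c).
Proof. by apply: bigcup_measurable => c _; exact: measurable_block_dies. Qed.

Lemma measurable_dead_block n : measurable (dead_block n).
Proof. by apply: bigcup_measurable => k _; exact: measurable_bigcup_block_dies. Qed.

Lemma near_large_progeny_le p : 0 < p ->
  \forall n \near \oo, (P (large_progeny n) <= p%:E)%E.
Proof.
move=> p0; near=> n.
have n0 : (0 < n)%N by near: n; exact: nbhs_infty_gt.
apply: le_trans (weighted_progeny_markov nat_rv_xi independent_xi xi_id mu_gt0 mean_xi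
  _ _ (expR_gt0 _)) _.
have ln_bound : ln ((immigrant_bound n)%:R : R) <= H * b n.
  have [->|N0] := posnP (immigrant_bound n).
    by rewrite ln0// mulr_ge0// ltW// b_gt0.
  by rewrite -[leRHS]expRK ler_ln ?posrE ?ltr0n ?expR_gt0// immigrant_bound_le.
rewrite lee_fin; move: ln_bound; move: (ln _); near: n.
by apply: near_progeny_mean_le => //; exact: horizon_small.
Unshelve. all: by end_near. Qed.

Lemma near_dead_block_le p : 0 < p ->
  \forall n \near \oo, (P (dead_block n) <= p%:E)%E.
Proof.
move=> p0; near=> n.
apply: (@le_trans _ _ ((horizon n)%:R * ((immigrant_bound n)%:R *
    expR (- (offspring_prob P xi ^+ horizon n * (block_size n)%:R))))%:E).
  apply: prob_bigcup_le => [k|k _]; first exact: measurable_bigcup_block_dies.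
  apply: prob_bigcup_le => [c|c _]; first exact: measurable_block_dies.
  exact: (block_dies_prob nat_rv_xi independent_xi xi_id mu_gt0 mean_xi).
have size_ge : expR (e / 2 * b n) <= (block_size n)%:R by exact/ltW/truncnS_gt.
rewrite lee_fin; move: (immigrant_bound_le n) size_ge.
move: (immigrant_bound n) (block_size n); near: n.
apply: near_extinction_le => //; first exact: horizon_small.
rewrite (offspring_prob_gt0 nat_rv_xi xi_id mu_gt0 mean_xi).
exact: (offspring_prob_le1 nat_rv_xi xi_id).
Unshelve. all: by end_near. Qed.

Lemma near_ln_block_size_le : \forall n \near \oo, ln (2 * (block_size n)%:R) <= e * b n.
Proof.
near=> n; have n0 : (0 < n)%N by near: n; exact: nbhs_infty_gt.
have bn := b_gt0 n0.
have exp_ge1 : 1 <= expR (e / 2 * b n) by rewrite ltW// expR_gt1 mulr_gt0.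
have size_le : (block_size n)%:R <= 2 * expR (e / 2 * b n).
  have := truncn_le (expR (e / 2 * b n)); rewrite expR_ge0 => trunc_le.
  by rewrite /block_size -natr1; lra.
apply: (@le_trans _ _ (ln (4 * expR (e / 2 * b n)))).
  by rewrite ler_ln ?posrE ?mulr_gt0 ?expR_gt0//; lra.
rewrite lnM ?posrE ?expR_gt0// expRK.
have : ln 4 / (e / 2) <= b n.
  by near: n; move/cvgryPge : b_cvg_pinfty; apply; exact: num_real.
by rewrite ler_pdivrMr//; lra.
Unshelve. all: by end_near. Qed.

Lemma tracks_of_typical_population n w : (0 < n)%N ->
  ln (2 * (block_size n)%:R) <= e * b n ->
  ~ large_progeny n w -> ~ dead_block n w ->
  (forall k, point_time R n k w < T -> (point_mark J b n k w <= H%:E)%E) ->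
  tracks T e ((@point_time R _ Omega n)^~ w) ((point_mark J b n)^~ w)
    (fun t => logp (GWI xi J (Num.truncn (n%:R * t)) w)%:R / b n).
Proof.
move=> n0 size_le typical alive marks_le; have bn := b_gt0 n0.
apply: (tracks_of_log_bounds (Y := GWI xi J ^~ w) (J := J ^~ w)) => // m mT.
have before k : (k < horizon n)%N = (k%:R / n%:R < T).
  by rewrite /horizon lt_count_before// ltW.
have mK : (m < horizon n)%N by rewrite before.
have bounded k : (k <= m)%N -> (J k w <= immigrant_bound n)%N.
  move=> km; rewrite truncn_ge_nat ?expR_ge0//.
  have [->|J0] := posnP (J k w); first exact: expR_ge0.
  rewrite -ler_ln ?posrE ?ltr0n ?expR_gt0// expRK -ler_pdivrMr// -lee_fin.
  by apply: marks_le; rewrite /point_time -before (leq_ltn_trans km).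
split=> [k km|Y0].
  apply: (@le_trans _ _ (logp (GWI xi J m w)%:R + ln (2 * (block_size n)%:R))).
    apply: (@ln_immigrants_le _ _ _ _ (horizon n) (immigrant_bound n)) => //.
      exact: bounded.
    move=> c cN dies; apply: alive; exists k; first exact: leq_ltn_trans mK.
    by exists c.
  by rewrite lerD2l.
have W_le : weighted_progeny xi R (horizon n) (immigrant_bound n) w <=
    expR (e / 2 * b n) by rewrite leNgt; apply/negP => /ltW.
have [k km YJ] := ln_GWI_le mK bounded W_le Y0; exists k => //.
by rewrite (le_trans YJ)// expRK lerD2l ler_wpM2r ?(ltW bn)//; have := e_gt0; lra.
Qed.

End horizon.

Lemma population_tracks : asymptotically_tracks P (@point_time R _ Omega) (point_mark J b)
  (fun n w t => logp (GWI xi J (Num.truncn (n%:R * t)) w)%:R / b n).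
Proof.
move=> T e H p T0 e0 H0 p0; have p2 : 0 < p / 2 by rewrite divr_gt0.
exists (fun n => large_progeny T e H n `|` dead_block T e H n); split.
- by move=> n; apply: measurableU;
    [exact: measurable_large_progeny|exact: measurable_dead_block].
- near=> n; have -> : p = p / 2 + p / 2 by lra.
  apply: probU_le; [exact: measurable_large_progeny|exact: measurable_dead_block| |].
    by near: n; exact: near_large_progeny_le.
  by near: n; exact: near_dead_block_le.
- near=> n => w /not_orP[typical alive].
  apply: (@tracks_of_typical_population _ _ H) => //.
    by near: n; exact: nbhs_infty_gt.
  by near: n; exact: near_ln_block_size_le.
Unshelve. all: by end_near. Qed.

End population_tracking.

(** * Conclusion *)

Theorem theorem2 (R : realType)
  (* the probability space carrying the process *)
  (d : measure_display) (Omega : measurableType d) (P : probability Omega R)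
  (* offspring numbers xi i k m l and immigrant numbers J k *)
  (xi : nat -> nat -> nat -> nat -> Omega -> nat) (J : nat -> Omega -> nat)
  (mu : R) (alpha : R) (l : R -> R) (b : nat -> R)
  (* a probability space carrying the limiting Poisson random measure *)
  (d' : measure_display) (Omega' : measurableType d') (Q : probability Omega' R)
  (mu1a : measure (\bar R) R)
  (tp : nat -> Omega' -> R) (jp : nat -> Omega' -> \bar R) :
  (* all xi's and J's are random variables, mutually independent *)
  (forall ix, nat_rv (GWI_family xi J ix)) ->
  mutually_independent P (GWI_family xi J) ->
  (* the xi's are identically distributed, the J's are identically distributed *)
  (forall i k m n i' k' m' n' (A : set nat),
      P (xi i k m n @^-1` A) = P (xi i' k' m' n' @^-1` A)) ->
  (forall k k' (A : set nat), P (J k @^-1` A) = P (J k' @^-1` A)) ->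
  (* offspring mean mu in (0,oo) *)
  0 < mu ->
  (\int[P]_w ((xi 1%N 0%N 0%N 0%N w)%:R : R)%:E)%E = mu%:E ->
  (* P{J = 0} < 1 *)
  (P (J 0%N @^-1` [set 0%N]) < 1)%E ->
  (* P{log J > x} ~ x^-alpha l(x) *)
  0 < alpha <= 1 ->
  slowly_varying l ->
  (fine (P [set w | x < ln (J 0 w)%:R]) / (x `^ (- alpha) * l x))
     @[x --> +oo] --> (1 : R) ->
  (alpha = 1 -> l x @[x --> +oo] --> +oo) ->
  (* normalizing sequence *)
  (forall n, (0 < n)%N -> 0 < b n) ->
  (n%:R * fine (P [set w | b n < ln (J 0 w)%:R])) @[n --> \oo] --> (1 : R) ->
  (* the limit: N^{(1,alpha)} = sum_k eps_{(tp k, jp k)} is a PRM with mean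
     measure Leb x mu_{1,alpha} on [0,oo) x (0,oo] *)
  is_mu_ab 1 alpha mu1a ->
  is_PRM Q tp jp (mean_measure mu1a) ->
  D_weak_cvg P
    (fun n w t => logp (GWI xi J (Num.truncn (n%:R * t)) w)%:R / b n)
    Q (sup_process tp jp).
Proof.
move=> nat_rv_family independent_family xi_id J_id mu_gt0 mean_xi _ alpha01 l_slow
  G_equiv l_pinfty b_gt0 nGb_cvg1 mu1a_alpha prm.
have nat_rv_xi i k m l : nat_rv (xi i k m l) := nat_rv_family (inl (i, k, m, l)).
have nat_rv_J k : nat_rv (J k) := nat_rv_family (inr k).
have independent_xi : mutually_independent P (offspring_family xi).
  exact: (mutually_independent_comp (@inl_inj _ _) independent_family).
have independent_J : mutually_independent P J.
  exact: (mutually_independent_comp (@inr_inj _ _) independent_family).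
have G_nincr := log_tail_nincr nat_rv_J J_id.
have G_ge0 := log_tail_ge0 P J.
have b_cvg_pinfty := normalizers_cvg_pinfty G_nincr G_ge0 G_equiv nGb_cvg1.
have b_superlinear := normalizers_superlinear G_nincr G_ge0 alpha01 l_slow G_equiv
  l_pinfty b_gt0 nGb_cvg1.
have tail_cvg := tail_scaled G_nincr G_ge0 l_slow G_equiv nGb_cvg1.
apply: (D_weak_cvg_of_points _ (points_asymptotically_poisson nat_rv_J J_id
  independent_J b_gt0 tail_cvg) (population_tracks J nat_rv_xi independent_xi xi_id
  mu_gt0 mean_xi b_gt0 b_cvg_pinfty b_superlinear) _
  (prm_asymptotically_poisson mu1a_alpha prm) (prm_tracks mu1a_alpha prm)).
  by case/andP: alpha01.
near=> n => w.
apply: (@cadlag_scaled_sequence R (fun m => logp (GWI xi J m w)%:R / b n)).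
by near: n; exact: nbhs_infty_gt.
Unshelve. all: by end_near. Qed.
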